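(* Let $T$ be a Calderón–Zygmund operator on $\mathbb{R}^n$ in the sense $T\in HCZ$. If $T: A^{0}_{1}\rightarrow WL^{1}$ (i.e. $\sup_{a\in A^0_1}\|Ta\|_{WL^1}<\infty$), then $T^{*}: A_{1}\rightarrow WL^{1}$ (i.e. $\sup_{a\in A_1}\|T^*a\|_{WL^1}<\infty$).
   Context: Notation. $B(u,t)$ is the ball in $\mathbb{R}^n$ with center $u$ and radius $t$; $|F|$ is the Lebesgue measure of $F$; $\chi_F$ is the characteristic function of $F$. The class $HCZ$. Let $T$ be a linear operator continuous from $\mathcal{S}(\mathbb{R}^n)$ to $\mathcal{S}'(\mathbb{R}^n)$, with kernel distribution $K(x,y)$, which is a locally integrable function off the diagonal $x=y$; $T^*$ denotes the adjoint (transposed) operator, with kernel $K(y,x)$. One writes $T\in HCZ$ if: (i) size condition: $\sup_{x,\,r>0}\int_{r\le|x-y|\le 2r}\{|K(x,y)|+|K(y,x)|\}\,dy<\infty$; (ii) Hörmander condition: $\sup_{x,x'}\int_{|x-y|\ge 2|x-x'|}\{|K(x,y)-K(x',y)|+|K(y,x)-K(y,x')|\}\,dy<\infty$; (iii) $T1\in \mathrm{BMO}$ and $T^*1\in\mathrm{BMO}$ (in the usual sense of the $T1$ theorem); (iv) weak boundedness: there is a constant $c$ such that for all $u\in\mathbb{R}^n$, $t>0$ and $f,g\in C^1_0(B(u,t))$, $|\langle Tf,g\rangle|\le c\,t^n(\|f\|_\infty+t\|\nabla f\|_\infty)(\|g\|_\infty+t\|\nabla g\|_\infty)$. Convention on the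 action of $T$. $T$ and $T^*$ are understood to act linearly also on bounded compactly supported functions $f$, with $Tf$, $T^*f$ measurable functions, consistently with the original definition on test functions, with $Tf(x)=\int K(x,y)f(y)\,dy$ for a.e. $x\notin\operatorname{supp} f$ (similarly for $T^*$), and with $\langle Tf,g\rangle=\langle f,T^*g\rangle$ whenever these pairings converge absolutely. Atoms. For a cube $E\subset\mathbb{R}^n$ let $N_E$ be the biggest integer such that $2^{N_E}|E|\le 1$. $a\in A_1(E)$ means $\operatorname{supp} a\subset E$, $\|a\|_\infty\le 2^{N_E}$ and $\int a(x)\,dx=0$. $a\in A^0_1(E)$ (characteristic atom) means that there are two sub-cubes $G$ and $H$ of $E$ which do not intersect each other and a (measurable) subset $F$ of $H$ with $|F|=|G|$ such that $a(x)=\frac{1}{|E|}(\chi_F(x)-\chi_G(x))$. $A_1$ and $A^0_1$ are the unions of $A_1(E)$ and $A^0_1(E)$, respectively, over all cubes $E$. Weak $L^1$. $WL^1=WL^1(\mathbb{R}^n)$ is the set of measurable $f$ with $\|f\|_{WL^1}=\sup_{\lambda>0}\lambda|\{x:|f(x)|>\lambda\}|<\infty$. *)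

(* Defs.v *)
From HB Require Import structures.
From mathcomp Require Import all_boot all_order all_algebra.
From mathcomp Require Import all_classical all_reals all_analysis.
From mathcomp Require Import ess_sup_inf.
From mathcomp.real_closed Require Import complex.
From mathcomp Require Import lra.
Set Implicit Arguments.
Unset Strict Implicit.
Unset Printing Implicit Defensive.
Import Order.TTheory GRing.Theory Num.Theory.
Import numFieldNormedType.Exports.
Local Open Scope classical_set_scope.
Local Open Scope ring_scope.

Local Notation Re := (@complex.Re _).
Local Notation Im := (@complex.Im _).

Section lebesgue_outer.
Context {R : realType} {n : nat}.
Local Notation V := 'rV[R]_n.
Implicit Types (a b : V) (A X : set V).

Definition box a b : set V := [set x | forall i, a 0 i <= x 0 i < b 0 i].

Definition box_vol a b : R := \prod_(i < n) Num.max 0 (b 0 i - a 0 i).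

(* The covers are finite or countable, so that the empty cover is allowed. *)
Definition lebesgue_outer A : \bar R :=
  ereal_inf [set s | exists (P : pred nat) (a b : nat -> V),
    A `<=` \bigcup_(k in [set k | P k]) box (a k) (b k) /\
    s = (\sum_(k <oo | P k) (box_vol (a k) (b k))%:E)%E].

Lemma box_vol_ge0 a b : 0 <= box_vol a b.
Proof. by apply: prodr_ge0 => i _; rewrite le_max lexx. Qed.

Local Open Scope ereal_scope.

Let vol_ge0 a b : 0 <= (box_vol a b)%:E.
Proof. by rewrite lee_fin box_vol_ge0. Qed.

Lemma lebesgue_outer_ge0 A : 0 <= lebesgue_outer A.
Proof.
apply: le_ereal_inf_tmp => _ [P [a [b [_ ->]]]].
by apply: nneseries_ge0 => k _ _; exact: vol_ge0.
Qed.

Lemma lebesgue_outer0 : lebesgue_outer set0 = 0.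
Proof.
apply/eqP; rewrite eq_le lebesgue_outer_ge0 andbT.
apply: ereal_inf_lbound; exists xpred0, (fun=> 0%R), (fun=> 0%R); split => //.
by rewrite eseries0.
Qed.

Lemma le_lebesgue_outer : {homo lebesgue_outer : A B / A `<=` B >-> A <= B}.
Proof.
move=> A B AB; apply/ereal_inf_le_tmp => _ [P [a [b [BP ->]]]].
by exists P, a, b; split => //; exact: subset_trans AB BP.
Qed.

Lemma lebesgue_outer_sigma_subadditive : sigma_subadditive lebesgue_outer.
Proof.
move=> A; have [[i ioo]|] := pselect (exists i, lebesgue_outer (A i) = +oo).
  rewrite (eseries_pinfty _ _ ioo) ?leey// => k _.
  by rewrite -ltNye (lt_le_trans _ (lebesgue_outer_ge0 _)).
rewrite -forallNE => Aoo.
apply/lee_addgt0Pr => e e0.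
rewrite (le_trans _ (epsilon_trick _ _ (ltW e0)))//; last first.
  by move=> k; exact: lebesgue_outer_ge0.
pose Q k (G : pred nat * (nat -> V) * (nat -> V)) :=
  A k `<=` \bigcup_(j in [set j | G.1.1 j]) box (G.1.2 j) (G.2 j) /\
  \sum_(j <oo | G.1.1 j) (box_vol (G.1.2 j) (G.2 j))%:E <=
    lebesgue_outer (A k) + (e / (2 ^ k.+1)%:R)%:E.
have [G PG] : {G & forall k, Q k (G k)}.
  apply: (@choice _ _ Q) => k.
  have ek0 : (0 < e / (2 ^ k.+1)%:R)%R by rewrite divr_gt0// ltr0n expn_gt0.
  have fk : lebesgue_outer (A k) \is a fin_num.
    rewrite ge0_fin_numE ?lebesgue_outer_ge0// ltey; apply/eqP; exact: Aoo.
  have [_ [P [a [b [AP ->]]]] H] := lb_ereal_inf_adherent ek0 fk.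
  by exists (P, a, b); split => //=; exact: ltW.
pose v (p : nat * nat) := (box_vol ((G p.1).1.2 p.2) ((G p.1).2 p.2))%:E.
pose J := fun k => [set j | (G k).1.1 j].
have /card_esym/ppcard_eqP[f] := card_nat2.
pose P : pred nat := fun m => (G (f m).1).1.1 (f m).2.
apply: (@le_trans _ _ (\sum_(m <oo | P m) v (f m))).
  apply: ereal_inf_lbound; exists P, (fun m => (G (f m).1).1.2 (f m).2),
    (fun m => (G (f m).1).2 (f m).2); split => // x [k _ Akx].
  have [j Gj xj] := (PG k).1 _ Akx.
  by exists (f^-1%FUN (k, j)); rewrite /P/= ?invK ?inE.
rewrite nneseries_esum; last by move=> *; exact: vol_ge0.
have -> : \esum_(m in [set m | P m]) v (f m) = \esum_(p in setT `*`` J) v p.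
  symmetry; apply: reindex_esum; split.
  - by move=> m /= Pm; split.
  - by move=> x y _ _; apply: (@inj _ _ _ f); rewrite inE.
  - move=> [k j] [_ /= Jkj]; exists (f^-1%FUN (k, j)); rewrite /= /P invK ?inE//.
have -> : \esum_(p in setT `*`` J) v p =
    \esum_(k in setT) \esum_(j in J k) v (k, j).
  rewrite (esum_esum (a := fun k j => v (k, j))); last by move=> *; exact: vol_ge0.
  by congr (esum _ _); apply/funext => -[].
rewrite nneseries_esumT; last first.
  move=> k; rewrite adde_ge0 ?lebesgue_outer_ge0// lee_fin divr_ge0 ?ler0n//.
  exact: ltW.
apply: le_esum => k _; apply: le_trans (PG k).2.
by rewrite nneseries_esum// => *; exact: vol_ge0.
Qed.

HB.instance Definition _ := isOuterMeasure.Build R V lebesgue_outer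
  lebesgue_outer0 lebesgue_outer_ge0 le_lebesgue_outer
  lebesgue_outer_sigma_subadditive.

End lebesgue_outer.

(* 'rV[R]_n carries the (complete) sigma-algebra of Lebesgue measurable sets. *)
Definition rV_display (R : realType) (n : nat) : measure_display :=
  caratheodory_display (@lebesgue_outer R n).

HB.instance Definition _ (R : realType) (n : nat) :=
  @isMeasurable.Build (rV_display R n) 'rV[R]_n
    (@lebesgue_outer R n).-caratheodory
    (@caratheodory_measurable_set0 _ _ (@lebesgue_outer R n))
    (@caratheodory_measurable_setC _ _ (@lebesgue_outer R n))
    (@caratheodory_measurable_bigcup _ _ (@lebesgue_outer R n)).

Section lebesgue_measure_rV.
Context {R : realType} {n : nat}.
Local Notation V := 'rV[R]_n.
Local Open Scope ereal_scope.

Definition lebesgue_rV : set V -> \bar R := lebesgue_outer.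

HB.instance Definition _ := isMeasure.Build _ V R lebesgue_rV
  (@caratheodory_measure0 R V lebesgue_outer)
  (@caratheodory_measure_ge0 R V lebesgue_outer)
  (@caratheodory_measure_sigma_additive R V lebesgue_outer).

Lemma box_vol_split (a b : V) (i : 'I_n) (c : R) :
  let b' := (\row_j if j == i then Num.min (b 0 j) c else b 0 j)%R in
  let a' := (\row_j if j == i then Num.max (a 0 j) c else a 0 j)%R in
  box_vol a b = (box_vol a b' + box_vol a' b)%R.
Proof.
move=> b' a'; rewrite /box_vol (bigD1 i)//= [X in (_ = X + _)%R](bigD1 i)//=.
rewrite [X in (_ = _ + X)%R](bigD1 i)//=.
rewrite [X in (_ = _ * X + _)%R](eq_bigr (fun j => Num.max 0 (b 0 j - a 0 j)))%R;
  last by move=> j /negbTE ji; rewrite mxE ji.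
rewrite [X in (_ = _ + _ * X)%R](eq_bigr (fun j => Num.max 0 (b 0 j - a 0 j)))%R;
  last by move=> j /negbTE ji; rewrite mxE ji.
rewrite -mulrDl; congr *%R; rewrite !mxE eqxx.
case: (leP (b 0 i)%R c) => bc; case: (leP (a 0 i)%R c) => ac; rewrite ?minElt ?maxElt;
  do ?case: ifPn => ?; lra.
Qed.

Lemma measurable_halfspace (i : 'I_n) (c : R) :
  measurable [set x : V | (x 0 i < c)%R].
Proof.
apply: (@le_caratheodory_measurable _ _ (@lebesgue_outer R n)) => X.
apply: le_ereal_inf_tmp => _ [P [a [b [XP ->]]]].
pose b' k : V := (\row_j if j == i then Num.min (b k 0 j) c else b k 0 j)%R.
pose a' k : V := (\row_j if j == i then Num.max (a k 0 j) c else a k 0 j)%R.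
rewrite [leRHS](_ : _ = \sum_(k <oo | P k) (box_vol (a k) (b' k))%:E +
                       \sum_(k <oo | P k) (box_vol (a' k) (b k))%:E).
  apply: leeD; apply: ereal_inf_lbound.
  - exists P, a, b'; split => // x [/XP[k Pk xk] /= xc]; exists k => // j.
    have /andP[-> xb] := xk j; rewrite mxE; case: eqP => [->|_]//=.
    by rewrite lt_min xc andbT; have /andP[] := xk i.
  - exists P, a', b; split => // x [/XP[k Pk xk] /= /negP]; rewrite -leNgt => cx.
    exists k => // j; have /andP[ax ->] := xk j.
    rewrite mxE andbT; case: eqP => [->|_]//=.
    by rewrite ge_max cx andbT; have /andP[] := xk i.
rewrite -nneseriesD; [|by move=> *; rewrite lee_fin box_vol_ge0..].
by apply: eq_eseriesr => k Pk; rewrite -EFinD (box_vol_split _ _ i c).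
Qed.

Lemma measurable_box (a b : V) : measurable (box a b).
Proof.
rewrite (_ : box a b = \bigcap_(i in [set: 'I_n])
    (~` [set x : V | (x 0 i < a 0 i)%R] `&` [set x : V | (x 0 i < b 0 i)%R])).
  apply: fin_bigcap_measurable => [|i _]; first exact: finite_finset.
  apply: measurableI; last exact: measurable_halfspace.
  by apply: measurableC; exact: measurable_halfspace.
apply/seteqP; split=> x /= abx i => [_|].
  by have /andP[ax xb] := abx i; split => //; apply/negP; rewrite -leNgt.
by have [/negP] := abx i I; rewrite -leNgt => ->.
Qed.

Lemma lebesgue_rV_box_le (a b : V) : lebesgue_rV (box a b) <= (box_vol a b)%:E.
Proof.
apply: ereal_inf_lbound; exists (pred1 0%N), (fun=> a), (fun=> b); split.
  by move=> x abx; exists 0%N => //=.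
rewrite nneseries_esum//; last by move=> *; rewrite lee_fin box_vol_ge0.
rewrite (_ : [set x | pred1 0%N x] = [set 0%N]); last first.
  by apply/seteqP; split => x /= /eqP.
by rewrite esum_set1// lee_fin box_vol_ge0.
Qed.

Lemma lebesgue_rV_sigma_finite : sigma_finite setT lebesgue_rV.
Proof.
pose Q (k : nat) : set V := box (const_mx (- k%:R)%R) (const_mx k%:R%R).
exists Q; last first.
  move=> k; split; first exact: measurable_box.
  by rewrite (le_lt_trans (lebesgue_rV_box_le _ _))// ltry.
apply/esym/seteqP; split => // x _.
exists (\sum_(i < n) (Num.truncn `|x 0%R i|%R).+1)%N => // i; rewrite !mxE.
have xn : (`|x 0%R i| < (\sum_(i < n) (Num.truncn `|x 0%R i|%R).+1)%:R)%R.
  rewrite (lt_le_trans (truncnS_gt _))// ler_nat (bigD1 i)//= leq_addr//.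
by have := xn; rewrite ltr_norml => /andP[/ltW -> ->].
Qed.

HB.instance Definition _ := Measure_isSigmaFinite.Build _ V R lebesgue_rV
  lebesgue_rV_sigma_finite.

End lebesgue_measure_rV.

Section complex_integral.
Context d (T : measurableType d) (R : realType).
Variable m : {measure set T -> \bar R}.
Implicit Types (D : set T) (f : T -> R[i]).

Definition cmeasurable D f :=
  measurable_fun D (fun x => Re (f x)) /\ measurable_fun D (fun x => Im (f x)).

Definition cintegrable D f :=
  m.-integrable D (fun x => (Re (f x))%:E) /\
  m.-integrable D (fun x => (Im (f x))%:E).

Definition cintegral D f : R[i] :=
  Complex (\int[m]_(x in D) Re (f x)) (\int[m]_(x in D) Im (f x)).

End complex_integral.

Section function_spaces.
Context {R : realType} {n : nat}.
Local Notation V := 'rV[R]_n.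
Local Notation C := R[i].
Local Notation absC := (@ComplexField.Normc.normc R).
Local Notation mu := (@lebesgue_rV R n).
Implicit Types (f g b : V -> C) (x u : V) (Q E : set V).

(* The library norm of 'rV[R]_n is the sup norm. *)
Definition enorm x : R := Num.sqrt (\sum_(i < n) x 0 i ^+ 2).

Definition eball u (t : R) : set V := [set x | enorm (x - u) < t].

Definition supp f : set V := closure [set x | f x != 0].

Definition Linfty_norm f : \bar R := ess_sup mu (fun x => (absC (f x))%:E).

Definition ccontinuous f :=
  continuous (fun x => Re (f x)) /\ continuous (fun x => Im (f x)).

Definition partial (i : 'I_n) f : V -> C := fun x =>
  Complex ('D_(delta_mx 0 i) (fun y => Re (f y)) x)
          ('D_(delta_mx 0 i) (fun y => Im (f y)) x).

Definition has_partial (i : 'I_n) f := forall x,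
  derivable (fun y => Re (f y)) x (delta_mx 0 i) /\
  derivable (fun y => Im (f y)) x (delta_mx 0 i).

Fixpoint class_C (k : nat) f : Prop :=
  if k is k'.+1 then
    ccontinuous f /\ forall i, has_partial i f /\ class_C k' (partial i f)
  else ccontinuous f.

Definition smooth f := forall k, class_C k f.

Definition iter_partial (s : seq 'I_n) f : V -> C := foldr partial f s.

Definition grad_norm f x : R :=
  Num.sqrt (\sum_(i < n) absC (partial i f x) ^+ 2).

Definition grad_Linfty_norm f : \bar R :=
  ess_sup mu (fun x => (grad_norm f x)%:E).

Definition test_function f := smooth f /\ compact (supp f).

Definition C10 (B : set V) f :=
  [/\ class_C 1 f, compact (supp f) & supp f `<=` B].

Definition schwartz_norm (k : nat) (s : seq 'I_n) f : \bar R :=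
  ereal_sup [set ((1 + enorm x) ^+ k * absC (iter_partial s f x))%:E
            | x in [set: V]].

Definition schwartz f :=
  smooth f /\ forall k s, (schwartz_norm k s f < +oo)%E.

Definition schwartz_cvg (F : nat -> V -> C) f := forall k s,
  schwartz_norm k s (fun x => F m x - f x) @[m --> \oo] --> (0 : \bar R).

(* S is metrizable, so that continuity on S is sequential continuity. *)
Definition schwartz_continuous (l : (V -> C) -> C) :=
  forall (F : nat -> V -> C) f, (forall m, schwartz (F m)) -> schwartz f ->
    schwartz_cvg F f -> absC (l (F m) - l f) @[m --> \oo] --> (0 : R).

Definition schwartz_linear (l : (V -> C) -> C) :=
  forall (c : C) f g, schwartz f -> schwartz g ->
    l (fun x => c * f x + g x) = c * l f + l g.

Definition tempered (l : (V -> C) -> C) :=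
  schwartz_linear l /\ schwartz_continuous l.

Definition bounded_compact_supp f :=
  [/\ cmeasurable setT f, (Linfty_norm f < +oo)%E & compact (supp f)].

Definition loc_integrable f := forall A, compact A -> cintegrable mu A f.

Definition is_cube Q := exists (a : V) (l : R),
  0 < l /\ Q = [set x | forall i, a 0 i <= x 0 i <= a 0 i + l].

Definition vol E : R := fine (mu E).

Definition average b Q : C := ((vol Q)^-1)%:C%C * cintegral mu Q b.

Definition BMO b := loc_integrable b /\
  (ereal_sup [set ((vol Q)^-1)%:E *
                  \int[mu]_(x in Q) (absC (b x - average b Q))%:E
             | Q in is_cube] < +oo)%E.

Definition WL1_norm f : \bar R :=
  ereal_sup [set (lam%:E * mu [set x | (lam < absC (f x))%R])%E
            | lam in [set lam : R | 0 < lam]].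

Definition is_N_ E (N : int) :=
  2 ^ N * vol E <= 1 /\ forall M : int, 2 ^ M * vol E <= 1 -> (M <= N)%R.

Definition N_ E : int := xget 0 (is_N_ E).

Definition A1_in E : set (V -> C) := [set a |
  [/\ cmeasurable setT a, supp a `<=` E, (Linfty_norm a <= (2 ^ N_ E)%:E)%E &
      cintegral mu setT a = 0]].

Definition A1 : set (V -> C) := \bigcup_(E in is_cube) A1_in E.

Definition A01_in E : set (V -> C) := [set a |
  exists G H F : set V,
    [/\ is_cube G /\ is_cube H, G `<=` E /\ H `<=` E, G `&` H = set0,
        [/\ measurable F, F `<=` H & mu F = mu G] &
        a = fun x => ((vol E)^-1 * (\1_F x - \1_G x))%:C%C]].

Definition A01 : set (V -> C) := \bigcup_(E in is_cube) A01_in E.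

End function_spaces.

Section operators.
Context (R : realType) (n : nat).
Local Notation V := 'rV[R]_n.
Local Notation C := R[i].
Local Notation absC := (@ComplexField.Normc.normc R).
Local Notation mu := (@lebesgue_rV R n).

(* An operator T : S -> S' is given through <Tf, g> = op_pairing T f g, which
   is meaningful for f and g in S; op_kernel T is K(x,y); op_fun T and
   op_adj T are T and its transpose T^* on bounded compactly supported
   functions, with functions as values.  All the requirements on these four
   data are in HCZ and extended_action below. *)
Record operator := Operator {
  op_pairing : (V -> C) -> (V -> C) -> C ;
  op_kernel : V -> V -> C ;
  op_fun : (V -> C) -> V -> C ;
  op_adj : (V -> C) -> V -> C }.

Implicit Types T : operator.

Definition adjoint T : operator := {|
  op_pairing := fun f g => op_pairing T g f ;
  op_kernel := fun x y => op_kernel T y x ;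
  op_fun := op_adj T ;
  op_adj := op_fun T |}.

(* S' has the weak-star topology; as S is a Frechet space, linear continuity
   into S' with its strong topology is the same. *)
Definition schwartz_operator T :=
  [/\ forall f, schwartz f -> tempered (op_pairing T f),
      forall g, schwartz g -> schwartz_linear (fun f => op_pairing T f g) &
      forall g, schwartz g -> schwartz_continuous (fun f => op_pairing T f g)].

Definition has_kernel T :=
  (forall A : set (V * V), compact A -> (forall z, A z -> z.1 != z.2) ->
     cintegrable (mu \x mu)%E A (fun z => op_kernel T z.1 z.2)) /\
  (forall f g, test_function f -> test_function g ->
     supp f `&` supp g = set0 ->
     op_pairing T f g = cintegral (mu \x mu)%E setT
       (fun z => op_kernel T z.1 z.2 * f z.2 * g z.1)).

Definition size_condition T := let K := op_kernel T in
  (ereal_sup [set \int[mu]_(y in [set y : V |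
                     (p.2 <= enorm (p.1 - y) <= 2 * p.2)%R])
                   (absC (K p.1 y) + absC (K y p.1))%:E
             | p in [set p : V * R | (0 < p.2)%R]] < +oo)%E.

Definition hormander_condition T := let K := op_kernel T in
  (ereal_sup [set \int[mu]_(y in [set y : V |
                     (enorm (p.1 - y) >= 2 * enorm (p.1 - p.2))%R])
                   (absC (K p.1 y - K p.2 y) + absC (K y p.1 - K y p.2))%:E
             | p in [set: V * V]] < +oo)%E.

(* T1 as a functional on the test functions g of integral 0: with supp g in
   the ball B(x0, r) and chi = 1 on B(x0, 2r), T1 is T chi + T(1 - chi), and
   <T(1 - chi), g> is made convergent by subtracting K(x0, y) from K(x, y),
   which changes T(1 - chi) by a constant. *)
Definition T1_in_BMO T := let K := op_kernel T in
  exists2 b : V -> C, BMO b &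
    forall (x0 : V) (r : R) (chi g : V -> C), 0 < r ->
      test_function chi -> (forall x, eball x0 (2 * r) x -> chi x = 1) ->
      test_function g -> supp g `<=` eball x0 r -> cintegral mu setT g = 0 ->
      cintegral mu setT (fun x => b x * g x) =
        op_pairing T chi g +
        cintegral mu setT (fun x =>
          g x * cintegral mu setT (fun y => (K x y - K x0 y) * (1 - chi y))).

(* C^1_0 functions need not be in S: <Tf, g> is the integral of (Tf) g, when it
   converges absolutely. *)
Definition weakly_bounded T := exists c : R,
  forall (u : V) (t : R) (f g : V -> C), 0 < t ->
    C10 (eball u t) f -> C10 (eball u t) g ->
    cintegrable mu setT (fun x => op_fun T f x * g x) ->
    ((absC (cintegral mu setT (fun x => op_fun T f x * g x)))%:E <=
     (c * t ^+ n)%:E * (Linfty_norm f + t%:E * grad_Linfty_norm f)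
                     * (Linfty_norm g + t%:E * grad_Linfty_norm g))%E.

Record HCZ T : Prop := {
  HCZ_operator : schwartz_operator T ;
  HCZ_kernel : has_kernel T ;
  HCZ_size : size_condition T ;
  HCZ_hormander : hormander_condition T ;
  HCZ_T1 : T1_in_BMO T ;
  HCZ_adjT1 : T1_in_BMO (adjoint T) ;
  HCZ_weakly_bounded : weakly_bounded T }.

Record extends_to_bounded T : Prop := {
  ext_measurable : forall f, bounded_compact_supp f ->
    cmeasurable setT (op_fun T f) ;
  ext_linear : forall (c : C) f g,
    bounded_compact_supp f -> bounded_compact_supp g ->
    {ae mu, forall x, op_fun T (fun y => c * f y + g y) x =
                      c * op_fun T f x + op_fun T g x} ;
  ext_consistent : forall f, test_function f ->
    loc_integrable (op_fun T f) /\
    forall g, test_function g ->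
      op_pairing T f g = cintegral mu setT (fun x => op_fun T f x * g x) ;
  ext_kernel : forall f, bounded_compact_supp f ->
    {ae mu, forall x, ~ supp f x ->
      op_fun T f x = cintegral mu setT (fun y => op_kernel T x y * f y)} }.

Definition extended_action T :=
  [/\ extends_to_bounded T, extends_to_bounded (adjoint T) &
    forall f g, bounded_compact_supp f -> bounded_compact_supp g ->
      cintegrable mu setT (fun x => op_fun T f x * g x) ->
      cintegrable mu setT (fun x => f x * op_adj T g x) ->
      cintegral mu setT (fun x => op_fun T f x * g x) =
      cintegral mu setT (fun x => f x * op_adj T g x)].

Definition bounded_to_WL1 T (A : set (V -> C)) :=
  (ereal_sup [set WL1_norm (op_fun T a) | a in A] < +oo)%E.

End operators.

(* Main.v *)
Require Import Defs.
From mathcomp Require Import all_boot all_order all_algebra.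
From mathcomp Require Import all_classical all_reals all_analysis.
From mathcomp Require Import ess_sup_inf measurable_realfun.
From mathcomp.real_closed Require Import complex.
From mathcomp Require Import ring lra.

(* The hypothesis makes every [T chi_F] a function of bounded mean oscillation.
   For F inside a cube H, let G be a cube at distance comparable to the side of
   H with |G| = |F|: chi_F - chi_G is a multiple of a characteristic atom and,
   by the size condition, [T chi_G] is bounded on H, so that [T chi_F] is small
   on H off a small proportion of H.  For a general bounded F and a cube Q, the
   part of F far from Q contributes on Q a constant up to a bounded error, by
   Hormander's condition.  Hence [T chi_F] is within [s] of a constant on each
   cube off a fixed small proportion of it, and the theorem of John and
   Stromberg bounds the integral of |T chi_F| over a cube Q containing F by
   C |Q|.

   Let now a be an atom of [A_1(E)], and Q a cube around E, of comparable
   volume.  If F is a part of Q where a real or imaginary part of [T^* a], up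
   to sign, exceeds t, then t |F| <= |<T^* a, chi_F>| = |<a, T chi_F>| <=
   |E|^-1 C |Q|.  Off Q, [T^* a] is integrable by Hormander's condition. *)

Set Implicit Arguments.
Unset Strict Implicit.
Unset Printing Implicit Defensive.
Import Order.TTheory GRing.Theory Num.Theory.
Import numFieldNormedType.Exports.
Local Open Scope classical_set_scope.
Local Open Scope ring_scope.

Local Notation Re := (@complex.Re _).
Local Notation Im := (@complex.Im _).
Local Notation absC := (@ComplexField.Normc.normc _).

(** * Cubes *)

Section cubes.
Context {R : realType} {n : nat}.
Local Notation V := 'rV[R]_n.
Local Notation mu := (@lebesgue_rV R n).
Implicit Types (a x y v : V) (l t : R) (A B : set V).

(** Atoms of [A1] are general bounded functions, while the hypothesis controls [T] only on
    differences of two indicators. Duality bridges the gap, since a level set of [T^* a] is measured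
    by testing against its own indicator. The test needs [T chi_F] to be integrable on a cube, and a
    weak-type bound alone does not give this: a tail of order 1/t in measure is not integrable. What
    helps is that the estimate holds on all cubes of all sizes at once. A deviation beyond [s] from
    some constant, on at most a proportion 2^-(n+3) of every cube, improves itself to a geometric
    decay of the tail. The transposition formula is granted only when both pairings converge
    absolutely. For [T chi_F] against the atom this follows from the integral bound; for [chi_F]
    against [T^* a] it is forced by cutting [F] down to the set where |T^* a| <= k, with estimates
    that do not depend on k. *)

Definition hcube a l : set V := [set x | forall i, a 0 i <= x 0 i < a 0 i + l].

(** Closed cubes carry the atoms and are compact, as the kernel formulas require; half-open cubes
    split exactly into their dyadic children. *)
Definition ccube a l : set V := [set x | forall i, a 0 i <= x 0 i <= a 0 i + l].

Local Open Scope ereal_scope.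

(** [mu] is the outer measure itself, so that monotonicity and subadditivity are available for
    arbitrary sets. *)
Lemma le_mu A B : A `<=` B -> mu A <= mu B.
Proof. exact: le_lebesgue_outer. Qed.

Lemma muU_le A B : mu (A `|` B) <= mu A + mu B.
Proof. exact: (outer_measureU2 (@lebesgue_outer R n)). Qed.

Lemma mu_bigcup_le (I : finType) (A : I -> set V) :
  mu (\bigcup_i A i) <= \sum_(i : I) mu (A i).
Proof.
have le_seq (s : seq I) : mu (\bigcup_(i in [set i | i \in s]) A i) <=
    \sum_(i <- s) mu (A i).
  elim: s => [|i s IH].
    rewrite big_nil (_ : \bigcup_(_ in _) _ = set0) ?measure0//.
    by apply/seteqP; split => // x [].
  rewrite big_cons (le_trans _ (leeD (lexx _) IH))// (le_trans _ (muU_le _ _))//.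
  apply: le_mu => x [j /=]; rewrite inE => /orP[/eqP-> ?|js Aj]; first by left.
  by right; exists j.
rewrite (le_trans _ (le_seq (index_enum I)))//.
by apply: le_mu => x [i _ Aix]; exists i => //=; exact: mem_index_enum.
Qed.

Lemma mu_negligible A : mu.-negligible A -> mu A = 0.
Proof.
case=> B [mB B0 AB]; apply/eqP; rewrite eq_le measure_ge0 andbT -B0.
exact: le_mu.
Qed.

Lemma mu_ae_le A B : {ae mu, forall x, A x -> B x} -> mu A <= mu B.
Proof.
move=> AB; have N0 := mu_negligible AB.
rewrite -[leRHS]adde0 -[X in _ <= _ + X]N0 (le_trans _ (muU_le _ _))//.
by apply: le_mu => x Ax; have [Bx|nBx] := pselect (B x); [left|right=> /(_ Ax)].
Qed.

(** Dilating a cover by boxes covers the image, and multiplies each volume by [t ^+ n]. *)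
Let mu_dilate_le t v A : (0 < t)%R ->
  mu [set (t *: x + v)%R | x in A] <= (t ^+ n)%:E * mu A.
Proof.
move=> t0; have tn0 : (0 < t ^+ n)%R by rewrite exprn_gt0.
rewrite -lee_pdivrMl//; apply: le_ereal_inf_tmp => _ [P [a [b [AP ->]]]].
rewrite lee_pdivrMl// -nneseriesZl; last by move=> k _; rewrite lee_fin box_vol_ge0.
apply: ereal_inf_lbound.
exists P, (fun k => t *: a k + v)%R, (fun k => t *: b k + v)%R; split.
  move=> _ [x /AP[k Pk xk] <-]; exists k => // i.
  by rewrite !mxE lerD2r ltrD2r ler_pM2l// ltr_pM2l.
apply: eq_eseriesr => k _; rewrite -EFinM; congr EFin.
rewrite /box_vol -{1}(card_ord n) -prodr_const -big_split/=.
by apply: eq_bigr => i _; rewrite !mxE maxr_pMr ?ltW// mulr0; congr Num.max; ring.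
Qed.

Lemma mu_dilate t v A : (0 < t)%R ->
  mu [set (t *: x + v)%R | x in A] = (t ^+ n)%:E * mu A.
Proof.
move=> t0; have tn0 : (0 < t ^+ n)%R by rewrite exprn_gt0.
apply/eqP; rewrite eq_le mu_dilate_le// -lee_pdivlMl//.
have ti0 : (0 < t^-1)%R by rewrite invr_gt0.
(* The reverse inequality is the same one for the inverse dilation. *)
have := mu_dilate_le (- (t^-1 *: v)) [set (t *: x + v)%R | x in A] ti0.
rewrite exprVn => le_A; rewrite (le_trans _ le_A)//; apply: le_mu => x Ax.
exists (t *: x + v)%R; first by exists x.
by rewrite scalerDr scalerA mulVf ?gt_eqF// scale1r addrK.
Qed.

Let hcubeE a l : (0 < l)%R -> hcube a l = [set (l *: x + a)%R | x in hcube 0 1].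
Proof.
move=> l0; apply/seteqP; split => x.
  move=> xa; exists (l^-1 *: (x - a))%R.
    move=> i; have /andP[ax xl] := xa i.
    rewrite !mxE add0r mulrC ler_pdivlMr// ltr_pdivrMr// mul0r mul1r.
    by rewrite subr_ge0 ax ltrBlDl.
  by rewrite scalerA divff ?gt_eqF// scale1r subrK.
move=> [y yc <-] i; have := yc i; rewrite !mxE add0r => /andP[y0 y1].
by rewrite lerDr mulr_ge0// ?ltW//= addrC ltrD2l gtr_pMr.
Qed.

Let ccubeE a l : (0 < l)%R -> ccube a l = [set (l *: x + a)%R | x in ccube 0 1].
Proof.
move=> l0; apply/seteqP; split => x.
  move=> xa; exists (l^-1 *: (x - a))%R.
    move=> i; have /andP[ax xl] := xa i.
    rewrite !mxE add0r mulrC ler_pdivlMr// ler_pdivrMr// mul0r mul1r.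
    by rewrite subr_ge0 ax lerBlDl.
  by rewrite scalerA divff ?gt_eqF// scale1r subrK.
move=> [y yc <-] i; have := yc i; rewrite !mxE add0r => /andP[y0 y1].
by rewrite lerDr mulr_ge0 ?(ltW l0)//= addrC lerD2l ger_pMr.
Qed.

Lemma hcube_box a l : hcube a l = box a (a + const_mx l).
Proof. by apply/seteqP; split => x xa i; have := xa i; rewrite !mxE. Qed.

Lemma hcube_ccube a l : hcube a l `<=` ccube a l.
Proof. by move=> x xa i; have /andP[-> /ltW ->] := xa i. Qed.

Lemma ccube_hcube a l t : (l < t)%R -> ccube a l `<=` hcube a t.
Proof.
by move=> lt x xa i; have /andP[-> xl] := xa i; rewrite (le_lt_trans xl)// ltrD2l.
Qed.

Lemma measurable_hcube a l : measurable (hcube a l).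
Proof. by rewrite hcube_box; exact: measurable_box. Qed.

Lemma measurable_ccube a l : measurable (ccube a l).
Proof.
rewrite (_ : ccube a l = \bigcap_k hcube a (l + k.+1%:R^-1)); last first.
  apply/seteqP; split => [x ax k _|x ax i].
    by apply: ccube_hcube ax; rewrite ltrDl invr_gt0.
  have /andP[-> _] := ax 0%N I i; apply/ler_addgt0Pr => e e0 /=.
  have /andP[_ /ltW/le_trans] := ax (Num.truncn e^-1) I i; apply.
  by rewrite addrA lerD2l invf_ple ?posrE// ltW// truncnS_gt.
by apply: bigcap_measurable => [|k _]; [exists 0%N|exact: measurable_hcube].
Qed.

(* Both masses are 1, but it is enough to know that they are comparable: if they
   vanish then so does the measure, and the theorem is trivial. *)
Definition hmass : R := fine (mu (hcube 0 1)).
Definition cmass : R := fine (mu (ccube 0 1)).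

Lemma mu_ccube_lty a l : mu (ccube a l) < +oo.
Proof.
rewrite (le_lt_trans (le_mu (ccube_hcube (t := l + 1) _)))// ?ltrDl//.
by rewrite hcube_box (le_lt_trans (lebesgue_rV_box_le _ _))// ltry.
Qed.

Lemma mu_hcube_lty a l : mu (hcube a l) < +oo.
Proof. exact: le_lt_trans (le_mu (@hcube_ccube _ _)) (mu_ccube_lty a l). Qed.

Lemma mu_hcube a l : (0 < l)%R -> mu (hcube a l) = (l ^+ n * hmass)%:E.
Proof.
move=> l0; rewrite hcubeE// mu_dilate// EFinM fineK//.
by rewrite ge0_fin_numE// mu_hcube_lty.
Qed.

Lemma mu_ccube a l : (0 < l)%R -> mu (ccube a l) = (l ^+ n * cmass)%:E.
Proof.
move=> l0; rewrite ccubeE// mu_dilate// EFinM fineK//.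
by rewrite ge0_fin_numE// mu_ccube_lty.
Qed.

Lemma hmass_ge0 : (0 <= hmass)%R. Proof. exact: fine_ge0. Qed.

Lemma hmass_cmass : (hmass <= cmass)%R.
Proof.
rewrite /hmass/cmass fine_le ?ge0_fin_numE ?mu_hcube_lty ?mu_ccube_lty//.
exact/le_mu/hcube_ccube.
Qed.

Lemma cmass_hmass : (cmass <= 2 ^+ n * hmass)%R.
Proof.
rewrite -lee_fin -(mu_hcube 0)// /cmass fineK ?ge0_fin_numE ?mu_ccube_lty//.
by apply/le_mu/ccube_hcube; rewrite ltr1n.
Qed.

Lemma mu_eq0 : hmass = 0%R -> mu [set: V] = 0.
Proof.
move=> h0; apply/eqP; rewrite eq_le measure_ge0 andbT.
have -> : [set: V] = \bigcup_k hcube (const_mx (- k.+1%:R))%R (2 * k.+1%:R)%R.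
  apply/esym/seteqP; split => // x _.
  exists (\sum_(i < n) (Num.truncn `|x 0%R i|%R).+1)%N => // i; rewrite !mxE.
  set N := (\sum_(i < n) _)%N.
  have xn : (`|x 0%R i| < N.+1%:R)%R.
    rewrite (lt_le_trans (truncnS_gt _))// ler_nat (leq_trans _ (leqnSn _))//.
    by rewrite /N (bigD1 i)//= leq_addr.
  move: xn; rewrite ltr_norml => /andP[? ?]; apply/andP; split; lra.
rewrite (le_trans (lebesgue_outer_sigma_subadditive _))//.
rewrite eseries0// => k _ _; rewrite -/(mu _) mu_hcube ?h0 ?mulr0//.
Qed.

Lemma compact_ccube a l : compact (ccube a l).
Proof.
have := @rV_compact R n (fun i => `[a 0 i, a 0 i + l]%classic)%R.
rewrite (_ : [set v | _] = ccube a l); first by apply=> i; exact: segment_compact.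
by apply/seteqP; split => x xa i; have := xa i; rewrite /= in_itv.
Qed.

Lemma closed_ccube a l : closed (ccube a l).
Proof. by apply: compact_closed; [exact: norm_hausdorff|exact: compact_ccube]. Qed.

End cubes.

(** * Outer regularity and continuity from below *)

Section regularity.
Context {R : realType} {n : nat}.
Local Notation V := 'rV[R]_n.
Local Notation mu := (@lebesgue_rV R n).
Implicit Types (a b x y : V) (l t : R) (A B : set V).
Local Open Scope ereal_scope.

(** The volume is continuous in the lower corner. A half-open box lacks room around its points only
    at the lower faces. *)
Lemma box_vol_enlarge a b (e : R) : (0 < e)%R ->
  exists2 d, (0 < d)%R & (box_vol (a - const_mx d) b <= box_vol a b + e)%R.
Proof.
move=> e0.
have cvg_vol : box_vol (a - const_mx d) b @[d --> (0:R)%R^'+] --> box_vol a b.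
  apply: cvg_big => [|i _]; first exact: mul_continuous.
  have -> : Num.max 0%R (b 0%R i - a 0%R i)%R =
      Num.max 0%R (b 0%R i - (a 0%R i - 0))%R by rewrite subr0.
  apply: (@cvg_trans _ ((fun d : R => Num.max 0 (b 0 i - (a 0 i - d)))%R @ 0^'+)%R).
    by apply: near_eq_cvg; near=> d; rewrite !mxE.
  apply: cvg_at_right_filter.
  apply: (@continuous_max R R (fun=> 0)%R (fun d => b 0 i - (a 0 i - d))%R).
    exact: cvg_cst.
  by apply: cvgB; [exact: cvg_cst|apply: cvgB; [exact: cvg_cst|exact: cvg_id]].
have : \forall d \near (0:R)%R^'+, (0 < d)%R /\
    (box_vol (a - const_mx d) b <= box_vol a b + e)%R.
  near=> d; split; first by near: d; exact: nbhs_right_gt.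
  near: d; apply: (cvgr_le (box_vol a b)) => //.
  by rewrite ltrDl.
by move=> /filter_ex[d [d0 d1]]; exists d.
Unshelve. all: by end_near. Qed.

(** [U] is a union of the boxes of a nearly optimal cover, with lower corners pushed out: half of
    [e] pays for the cover and half for the enlargements. The last clause plays the role of
    openness: [U] contains a sup-norm neighbourhood of each point of [A]. *)
Lemma outer_regular A (e : R) : (0 < e)%R -> exists U : set V,
  [/\ measurable U, mu U <= mu A + e%:E &
      forall x, A x -> exists2 d, (0 < d)%R &
        forall y, (forall i, `|y 0%R i - x 0%R i| < d)%R -> U y].
Proof.
move=> e0; have [Aoo|Afin] := eqVneq (mu A) +oo.
  exists setT; split; [exact: measurableT|by rewrite Aoo addye// leey|].
  by move=> x _; exists 1%R.
have e20 : (0 < e / 2)%R by rewrite divr_gt0.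
have Afn : lebesgue_outer A \is a fin_num.
  by rewrite ge0_fin_numE ?lebesgue_outer_ge0// ltey.
have [_ [P [a [b [AP ->]]]] Ple] := lb_ereal_inf_adherent e20 Afn.
pose Q k (d : R) := ((0 < d) /\ (box_vol (a k - const_mx d) (b k) <=
    box_vol (a k) (b k) + (e / 2) / (2 ^ k.+1)%:R))%R.
have [d dP] : {d : nat -> R & forall k, Q k (d k)}.
  apply: (@choice _ _ Q) => k.
  have ek0 : (0 < e / 2 / (2 ^ k.+1)%:R)%R by rewrite divr_gt0// ltr0n expn_gt0.
  by have [d ? ?] := box_vol_enlarge (a k) (b k) ek0; exists d.
exists (\bigcup_(k in [set k | P k]) box (a k - const_mx (d k)) (b k)); split.
- by apply: bigcup_measurable => k _; exact: measurable_box.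
- apply: (@le_trans _ _ (\sum_(k <oo | P k)
      (box_vol (a k - const_mx (d k)) (b k))%:E)).
    rewrite -[leLHS]/(lebesgue_outer _); apply: ereal_inf_lbound => /=.
    by exists P, (fun k => a k - const_mx (d k))%R, b; split.
  apply: (@le_trans _ _ (\sum_(k <oo | P k) ((box_vol (a k) (b k))%:E +
      (e / 2 / (2 ^ k.+1)%:R)%:E))).
    apply: lee_nneseries => k _; rewrite ?lee_fin ?box_vol_ge0//.
    by have [] := dP k.
  rewrite (le_trans (epsilon_trick _ _ (ltW e20)))//.
    by move=> k; rewrite lee_fin box_vol_ge0.
  rewrite [in leRHS](splitr e) [in leRHS]EFinD addeA leeD2r//.
  exact: ltW.
- move=> x /AP[k Pk xk].
  (* The room is [d k] on the side of the lower faces and the least distance to the upper faces on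
     the other side. *)
  exists (\big[Num.min/d k]_i (b k 0 i - x 0 i))%R.
    apply: lt_bigmin => [|i _]; first by have [] := dP k.
    by have /andP[_] := xk i; rewrite subr_gt0.
  move=> y yx; exists k => // i; have := yx i; have /andP[xa xb] := xk i.
  rewrite !mxE ltr_norml => /andP[yx1 yx2].
  have m1 := bigmin_le_id (index_enum _) (d k) xpredT (fun i => b k 0 i - x 0 i)%R.
  have m2 := bigmin_le (d k) i (fun i => b k 0 i - x 0 i)%R.
  by apply/andP; split; lra.
Qed.

Lemma mu_bigcup_sup_le (A : (set V)^nat) (c : \bar R) :
  (forall k, measurable (A k)) -> (forall k, A k `<=` A k.+1) ->
  (forall k, mu (A k) <= c) -> mu (\bigcup_k A k) <= c.
Proof.
move=> mA ndA Ac.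
have : mu (A k) @[k --> \oo] --> mu (\bigcup_k A k).
  apply: nondecreasing_cvg_mu => //; first exact: bigcupT_measurable.
  by apply/nondecreasing_seqP => k; exact/subsetPset/ndA.
move=> /[dup] cA /cvg_lim <-//; apply: lime_le; first by apply/cvg_ex; eexists; exact: cA.
exact: nearW.
Qed.

End regularity.

(** * The John-Stromberg inequality *)

Section dyadic.
Context {R : realType} {n : nat}.
Local Notation V := 'rV[R]_n.
Local Notation mu := (@lebesgue_rV R n).
Implicit Types (a b x y : V) (l t : R) (A B U : set V).
Local Open Scope ereal_scope.

Definition child a l (e : {ffun 'I_n -> bool}) : V :=
  (\row_i (a 0 i + (if e i then l / 2 else 0)))%R.

Lemma hcube_children a l : (0 < l)%R ->
  hcube a l = \bigcup_e hcube (child a l e) (l / 2).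
Proof.
move=> l0; apply/seteqP; split => [x xa|x [e _ xe] i].
  exists [ffun i => a 0 i + l / 2 <= x 0 i]%R => // i.
  rewrite !mxE ffunE; have /andP[? ?] := xa i.
  by case: (leP (a 0 i + l / 2) (x 0 i))%R => ?; apply/andP; split; lra.
have := xe i; rewrite !mxE => /andP[]; case: (e i) => ? ?; apply/andP; split; lra.
Qed.

Lemma trivIset_children a l B : (0 < l)%R ->
  trivIset setT (fun e => B `&` hcube (child a l e) (l / 2)).
Proof.
move=> l0; apply/trivIsetP => e f _ _ /eqP ef; apply/seteqP; split => // x.
move=> [[_ xe] [_ xf]]; apply: ef; apply/ffunP => i.
have := xe i; have := xf i; rewrite !mxE => /andP[+ +] /andP[].
by case: (e i); case: (f i) => // ? ? ? ?; exfalso; lra.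
Qed.

Lemma mu_children a l B : (0 < l)%R -> measurable B ->
  mu (B `&` hcube a l) =
  \sum_(e : {ffun 'I_n -> bool}) mu (B `&` hcube (child a l e) (l / 2)).
Proof.
move=> l0 mB; rewrite hcube_children// setI_bigcupr measure_fin_bigcup//.
- rewrite (@bigfs _ _ _ _ (index_enum _) xpredT) ?index_enum_uniq//.
    by apply: eq_fsbigl; apply/seteqP.
  by move=> i _; rewrite mem_index_enum.
- exact: finite_finset.
- exact: trivIset_children.
- by move=> e _; apply: measurableI => //; exact: measurable_hcube.
Qed.

(* [N] bounds the generation of the subcubes.  As [U] fills such a subcube, the
   stopping argument below does not need Lebesgue's density theorem. *)
Fixpoint dyadic_part U (N : nat) a l : set V :=
  [set x | hcube a l x /\ (hcube a l `<=` U \/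
    if N is N'.+1 then exists e, dyadic_part U N' (child a l e) (l / 2) x
    else False)].

Lemma dyadic_part_sub U N a l : dyadic_part U N a l `<=` hcube a l.
Proof. by case: N => [|N] x []. Qed.

Lemma dyadic_partS U N a l : (0 < l)%R -> ~ hcube a l `<=` U ->
  dyadic_part U N.+1 a l = \bigcup_e dyadic_part U N (child a l e) (l / 2).
Proof.
move=> l0 aU; apply/seteqP; split => x; first by move=> [xa [//|[e xe]]]; exists e.
move=> [e _ xe]; split; last by right; exists e.
by rewrite hcube_children//; exists e => //; exact: dyadic_part_sub xe.
Qed.

Lemma dyadic_part_full U N a l : hcube a l `<=` U -> dyadic_part U N a l = hcube a l.
Proof.
move=> aU; apply/seteqP; split; first exact: dyadic_part_sub.
by case: N => [|N] x ax; split => //; left.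
Qed.

Lemma dyadic_part_nd U N a l : (0 < l)%R ->
  dyadic_part U N a l `<=` dyadic_part U N.+1 a l.
Proof.
elim: N a l => [|N IH] a l l0 x /= [xa]; first by move=> [?|//]; split => //; left.
move=> [?|[e xe]]; split => //; first by left.
by right; exists e; apply: (IH _ _ _ _ xe); rewrite divr_gt0.
Qed.

Lemma measurable_dyadic_part U N a l : (0 < l)%R -> measurable (dyadic_part U N a l).
Proof.
elim: N a l => [|N IH] a l l0; have [aU|aU] := pselect (hcube a l `<=` U).
- by rewrite dyadic_part_full//; exact: measurable_hcube.
- rewrite (_ : dyadic_part U 0 a l = set0)//.
  by apply/seteqP; split => // x [_ []].
- by rewrite dyadic_part_full//; exact: measurable_hcube.
- rewrite dyadic_partS//; apply: fin_bigcup_measurable => [|e _].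
    exact: finite_finset.
  by apply: IH; rewrite divr_gt0.
Qed.

(** Halving brings the side below [d], and the subcube around [x] then lies in [U]. So the dyadic
    parts exhaust the points of the cube that have room in [U]. *)
Lemma dyadic_part_room U a l x d : (0 < l)%R -> (0 < d)%R -> hcube a l x ->
  (forall y, (forall i, `|y 0 i - x 0 i| < d)%R -> U y) ->
  exists N, dyadic_part U N a l x.
Proof.
move=> l0 d0 xa xU.
have [N lN] : exists N : nat, (l / 2 ^+ N < d)%R.
  exists (Num.truncn (l / d)); rewrite ltr_pdivrMr ?exprn_gt0// mulrC.
  rewrite -ltr_pdivrMr// (lt_le_trans (truncnS_gt _))// -natrX ler_nat.
  exact: ltn_expl.
exists N; elim: N a l l0 xa lN => [|N IH] a l l0 xa lN.
  split => //; left => y ya; apply: xU => i; move: lN; rewrite expr0 divr1 => lN.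
  have /andP[? ?] := xa i; have /andP[? ?] := ya i.
  by rewrite ltr_norml; apply/andP; split; lra.
split => //; right; move: (xa); rewrite hcube_children// => -[e _ xe].
exists e; apply: IH => //; first by rewrite divr_gt0.
by rewrite -mulrA -invfM -exprS.
Qed.

End dyadic.

Section john_stromberg.
Context {R : realType} {n : nat}.
Local Notation V := 'rV[R]_n.
Local Notation mu := (@lebesgue_rV R n).
Implicit Types (a x y : V) (l t : R) (U : set V) (N k : nat).
Local Open Scope ereal_scope.
Context (hmass_gt0 : (0 < @hmass R n)%R).
Context (f : V -> R) (c : V -> R -> R) (s : R).
Context (s_gt0 : (0 < s)%R) (mf : measurable_fun setT f).

Let dev (t c0 : R) : set V := [set x | (t < `|f x - c0|)%R].

Context (small_dev : forall a l, (0 < l)%R ->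
  mu (hcube a l `&` dev s (c a l)) <= ((2 ^+ n.+3)^-1)%:E * mu (hcube a l)).

Let measurable_dev t c0 : measurable (dev t c0).
Proof.
have mg : measurable_fun setT (fun x => `|f x - c0|)%R.
  apply: measurableT_comp; first exact: normr_measurable.
  by apply: measurable_funB => //; exact: measurable_cst.
rewrite (_ : dev t c0 = setT `&` (fun x => `|f x - c0|)%R @^-1` `]t, +oo[).
  exact: mg.
by apply/seteqP; split => [x|x [_]]; rewrite /dev /= in_itv/= andbT.
Qed.

Let mu_hcube_gt0 a l : (0 < l)%R -> 0 < mu (hcube a l).
Proof. by move=> l0; rewrite mu_hcube// lte_fin mulr_gt0// exprn_gt0. Qed.

(** Off [U] the function is within [s] of [c0], and off a proportion at most 1/8 it is within [s] of
    [c a l]. As 1/2 + 1/8 < 1, both happen at some point of the cube. *)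
Let close_centers a l c0 U : (0 < l)%R -> hcube a l `&` dev s c0 `<=` U ->
  mu (U `&` hcube a l) <= (2^-1)%:E * mu (hcube a l) ->
  (`|c a l - c0| <= 2 * s)%R.
Proof.
move=> l0 devU Ul; rewrite leNgt; apply/negP => cc0.
have : mu (hcube a l) <= mu (U `&` hcube a l) + mu (hcube a l `&` dev s (c a l)).
  rewrite (le_trans _ (muU_le _ _))//; apply: le_mu => x xa.
  have [?|] := ltP s `|f x - c a l|%R; first by right.
  move=> fc; left; split => //; apply: devU; split => //; rewrite /dev/= ltNge.
  apply/negP => fc0; move: cc0; rewrite ltNge => /negP; apply.
  rewrite (_ : (c a l - c0 = f x - c0 - (f x - c a l))%R); last by ring.
  by rewrite (le_trans (ler_normB _ _))//; lra.
apply/negP; rewrite -ltNge.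
rewrite (le_lt_trans (leeD Ul (small_dev a l0)))// mu_hcube// -!EFinM -EFinD lte_fin.
rewrite -mulrDl gtr_pMl ?mulr_gt0 ?exprn_gt0//.
have : ((2 ^+ n.+3)^-1 <= (2 ^+ 3)^-1 :> R)%R.
  by rewrite lef_pV2 ?posrE ?exprn_gt0// ler_eXn2l ?ltr1n.
by lra.
Qed.

(** Stopping argument: descend through dyadic subcubes until [U] fills a proportion above 2^-(n+1).
    On a stopped cube the centre is within [2 * s] of [c0], so that deviating by [t + 2 * s] from
    [c0] forces a deviation by [t] from that centre; and the cube has less than 2^(n+1) times the
    measure of its part in [U]. *)
Let step U (r t c0 : R) N a l : (0 < l)%R -> (0 <= r)%R -> measurable U ->
  (forall a l, (0 < l)%R ->
     mu (hcube a l `&` dev t (c a l)) <= r%:E * mu (hcube a l)) ->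
  hcube a l `&` dev s c0 `<=` U ->
  mu (U `&` hcube a l) <= (2^-1)%:E * mu (hcube a l) ->
  mu (dev (t + 2 * s) c0 `&` dyadic_part U N a l) <=
    (r * 2 ^+ n.+1)%:E * mu (U `&` hcube a l).
Proof.
move=> + r0 mU dev_le; elim: N a l => [|N IH] a l l0 devU Ul.
  (* At generation 0 only a cube filled by [U] contributes, and density at most 1/2 excludes it. *)
  rewrite (_ : dyadic_part U 0 a l = set0).
    by rewrite setI0 measure0 mule_ge0// lee_fin mulr_ge0// exprn_ge0.
  apply/seteqP; split => // x [_ [aU|//]].
  move: Ul; rewrite setIidr// leNgt => /negP; apply.
  by rewrite mu_hcube// -EFinM lte_fin gtr_pMl ?mulr_gt0 ?exprn_gt0//; lra.
have [dense|sparse] := ltP ((2 ^+ n.+1)^-1%:E * mu (hcube a l)) (mu (U `&` hcube a l)).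
  have cc0 := close_centers l0 devU Ul.
  apply: (@le_trans _ _ (mu (hcube a l `&` dev t (c a l)))).
    apply: le_mu => x [xd /dyadic_part_sub xa]; split => //.
    move: xd; rewrite /dev /= => xd.
    have := ler_normD (f x - c a l)%R (c a l - c0)%R; rewrite subrKA; lra.
  rewrite (le_trans (dev_le _ _ l0))// EFinM -muleA lee_wpmul2l ?lee_fin//.
  by rewrite -lee_pdivrMl ?exprn_gt0// ltW.
have aU : ~ hcube a l `<=` U.
  move=> aU; move: Ul; rewrite setIidr// leNgt => /negP; apply.
  by rewrite mu_hcube// -EFinM lte_fin gtr_pMl ?mulr_gt0 ?exprn_gt0//; lra.
rewrite dyadic_partS// setI_bigcupr (le_trans (mu_bigcup_le _))//.
rewrite mu_children// ge0_sume_distrr; last by move=> *; exact: measure_ge0.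
have l20 : (0 < l / 2)%R by rewrite divr_gt0.
have childS e : hcube (child a l e) (l / 2) `<=` hcube a l.
  by move=> x xe; rewrite hcube_children//; exists e.
apply: lee_sum => e _; apply: IH => //.
- by move=> x [/childS ? ?]; exact: devU.
(* A child has 2^-n of the measure of its parent, so that density at most 2^-(n+1) in the parent
   gives density at most 1/2 in the child. *)
- rewrite (@le_trans _ _ (mu (U `&` hcube a l)))//.
    by apply: le_mu => x [Ux /childS].
  rewrite (le_trans sparse)// !mu_hcube// -!EFinM lee_fin.
  rewrite expr_div_n exprS invfM le_eqVlt; apply/orP; left; apply/eqP.
  by field; rewrite expf_neq0.
Qed.

(** One round adds [2 * s] to the threshold and halves the proportion: [U] fills at most twice the
    proportion 2^-(n+3), and [step] costs 2^(n+1). This is where the constant of [small_dev] comes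
    from. *)
Let dev_decay k a l : (0 < l)%R ->
  mu (hcube a l `&` dev ((k.*2.+1)%:R * s) (c a l)) <= ((2 ^+ k)^-1)%:E * mu (hcube a l).
Proof.
elim: k a l => [|k IH] a l l0.
  rewrite mul1r (le_trans (small_dev _ l0))// lee_wpmul2r// lee_fin.
  by rewrite lef_pV2 ?posrE ?exprn_gt0// ler_eXn2l ?ltr1n.
set D := hcube a l `&` _.
pose th : R := ((2 ^+ n.+3)^-1)%R.
have small : mu (hcube a l `&` dev s (c a l)) <= th%:E * mu (hcube a l).
  exact: small_dev.
have th0 : (0 < th)%R by rewrite invr_gt0 exprn_gt0.
have e0 : (0 < th * (l ^+ n * @hmass R n))%R by rewrite !mulr_gt0 ?exprn_gt0.
have [U [mU muU SU]] := outer_regular (hcube a l `&` dev s (c a l)) e0.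
have Ule : mu U <= (2 * th)%:E * mu (hcube a l).
  rewrite (le_trans muU)// (le_trans (leeD (small_dev _ l0) (lexx _)))//.
  by rewrite mu_hcube// -!EFinM -EFinD lee_fin -mulrA mulr_natl mulr2n.
have DU : hcube a l `&` dev s (c a l) `<=` U.
  by move=> x /SU[d d0]; apply => i; rewrite subrr normr0.
have th8 : (th <= 8^-1)%R.
  rewrite lef_pV2 ?posrE ?exprn_gt0// (_ : 8 = 2 ^+ 3 :> R)%R; last by rewrite -natrX.
  by rewrite ler_eXn2l ?ltr1n.
have Ul : mu (U `&` hcube a l) <= (2^-1)%:E * mu (hcube a l).
  rewrite (le_trans _ (le_trans Ule _))//; first by apply: le_mu => x [].
  by rewrite lee_wpmul2r// lee_fin; lra.
(* A point of [D] also deviates by more than [s]; hence it has room in [U] and is reached at some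
   generation. *)
have : D `<=` \bigcup_N (dev (k.*2.+1%:R * s + 2 * s) (c a l) `&` dyadic_part U N a l).
  move=> x [xa xD]; have xD' : dev s (c a l) x.
    rewrite /dev/= in xD *; rewrite (le_lt_trans _ xD)//.
    by rewrite ler_peMl ?(ltW s_gt0)// ler1n.
  have [d d0 xU] := SU x (conj xa xD').
  have [N xN] := dyadic_part_room l0 d0 xa xU.
  exists N => //; split => //; move: xD; rewrite /dev/=.
  by rewrite -mulrDl -natrD doubleS -addn2 addSn.
move=> /le_mu/le_trans; apply.
apply: mu_bigcup_sup_le => [N|N|N].
- apply: measurableI => //; exact: measurable_dyadic_part.
- by apply: setIS; exact: dyadic_part_nd.
have k0 : (0 <= (2 ^+ k)^-1 :> R)%R by rewrite invr_ge0 exprn_ge0.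
rewrite (le_trans (step N l0 k0 mU IH DU Ul))//.
rewrite (@le_trans _ _ (((2 ^+ k)^-1 * 2 ^+ n.+1)%:E * mu U))//.
  by rewrite lee_wpmul2l ?lee_fin ?mulr_ge0 ?invr_ge0 ?exprn_ge0//; apply: le_mu => x [].
rewrite (le_trans (lee_wpmul2l _ Ule))// ?lee_fin ?mulr_ge0 ?invr_ge0 ?exprn_ge0//.
rewrite muleA -EFinM lee_wpmul2r// lee_fin le_eqVlt; apply/orP; left; apply/eqP.
by rewrite /th !exprS; field; rewrite !expf_neq0.
Qed.

(** The deviation is cut into layers of height [2 * s], over sets whose measure decays
    geometrically. *)
Lemma john_stromberg a l : (0 < l)%R ->
  \int[mu]_(x in hcube a l) (`|f x - c a l|)%:E <= (8 * s)%:E * mu (hcube a l).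
Proof.
move=> l0; set Q := hcube a l.
have mQ : measurable Q by exact: measurable_hcube.
pose D k := dev ((k.*2.+1)%:R * s) (c a l).
pose h k x : \bar R := if k is k'.+1 then (2 * s)%:E * (\1_(D k') x)%:E else s%:E.
have mD k : measurable (D k) by exact: measurable_dev.
have h0 k x : 0 <= h k x.
  case: k => [|k] /=; first by rewrite lee_fin ltW.
  by rewrite -EFinM lee_fin !mulr_ge0// (ltW s_gt0).
have mh k : measurable_fun Q (h k).
  case: k => [|k] /=; first exact: measurable_cst.
  apply: emeasurable_funM; first exact: measurable_cst.
  by apply/measurable_EFinP; exact: measurable_indic.
have fh x : (`|f x - c a l|)%:E <= \sum_(k <oo) h k x.
  have exm : exists m : nat, (`|f x - c a l| <= m.*2.+1%:R * s)%R.
    exists (Num.truncn (`|f x - c a l| / s)%R); rewrite -ler_pdivrMr//.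
    by rewrite ltW// (lt_le_trans (truncnS_gt _))// ler_nat ltnS -addnn leq_addr.
  (* By minimality [x] lies in the first [m] sets [D k], so that the sum is at least
     [s + 2 * s * m]. *)
  case: (ex_minnP exm) => m fm mmin.
  rewrite (le_trans _ (nneseries_lim_ge m.+1 _))//.
  rewrite big_mkord big_ord_recl/= -ge0_sume_distrr; last first.
    by move=> i _; rewrite lee_fin.
  rewrite (eq_bigr (fun=> 1%:E)); last first.
    move=> i _; rewrite indicE mem_set// /D /dev/= ltNge; apply/negP => /mmin.
    by rewrite leqNgt ltn_ord.
  rewrite sumEFin sumr_const card_ord -EFinM -EFinD lee_fin.
  by move: fm; rewrite -addnn -addn1 !natrD; lra.
rewrite (@le_trans _ _ (\int[mu]_(x in Q) \sum_(k <oo) h k x))//.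
  apply: ge0_le_integral => //.
  - apply/measurable_EFinP; apply: measurable_funTS.
    apply: measurableT_comp; first exact: normr_measurable.
  by apply: measurable_funB => //; exact: measurable_cst.
  - by apply: ge0_emeasurable_sum.
rewrite integral_nneseries//.
(* With the factor 8, the layer [h k.+1] has integral at most [e / 2 ^ k.+2]; [epsilon_trick],
   applied to the zero series, then sums these bounds. *)
pose e := (8 * s * fine (mu Q))%R.
have e0 : (0 <= e)%R by rewrite !mulr_ge0// ?(ltW s_gt0)// fine_ge0.
have muQ : mu Q = (fine (mu Q))%:E by rewrite fineK// ge0_fin_numE// mu_hcube_lty.
have -> : (8 * s)%:E * mu Q = \sum_(k <oo) (cst 0 k : \bar R) + e%:E.
  by rewrite eseries0// add0e muQ -EFinM.
apply: le_trans (epsilon_trick _ _ e0) => //.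
apply: lee_nneseries => k _; first by rewrite integral_ge0.
rewrite add0e; case: k => [|k] /=.
  have -> : \int[mu]_(_ in Q) s%:E = s%:E * mu Q by exact: integral_cst.
  rewrite muQ -EFinM lee_fin /e expn1.
  have : (0 <= s * fine (mu Q))%R by rewrite mulr_ge0 ?(ltW s_gt0)// fine_ge0.
  by lra.
rewrite ge0_integralZl_EFin//; last 2 first.
- by apply/measurable_EFinP; exact: measurable_indic.
- by rewrite mulr_ge0 ?(ltW s_gt0).
rewrite integral_indic// setIC.
rewrite (le_trans (lee_wpmul2l _ (dev_decay k a l0)))// ?lee_fin ?mulr_ge0// ?(ltW s_gt0)//.
rewrite -/Q muQ -!EFinM lee_fin /e natrX !exprS le_eqVlt; apply/orP; left; apply/eqP.
by field; rewrite expf_neq0.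
Qed.

End john_stromberg.

(** * Complex integrals and sections *)

Section modulus.
Context {R : realType}.
Implicit Types z w : R[i].

Lemma absCE z : absC z = Num.sqrt (Re z ^+ 2 + Im z ^+ 2).
Proof. by case: z. Qed.

Lemma absC_ge0 z : 0 <= absC z.
Proof. by rewrite absCE sqrtr_ge0. Qed.

Lemma normRe_le z : `|Re z| <= absC z.
Proof. by rewrite absCE -sqrtr_sqr ler_wsqrtr// lerDl sqr_ge0. Qed.

Lemma normIm_le z : `|Im z| <= absC z.
Proof. by rewrite absCE -sqrtr_sqr ler_wsqrtr// lerDr sqr_ge0. Qed.

Lemma absC_le z : absC z <= `|Re z| + `|Im z|.
Proof.
rewrite absCE -[leRHS]ger0_norm ?addr_ge0// -sqrtr_sqr ler_wsqrtr//.
rewrite sqrrD !real_normK ?num_real//.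
by rewrite -addrA lerD2l lerDr mulrn_wge0// mulr_ge0.
Qed.

Lemma absCD z w : absC (z + w) <= absC z + absC w.
Proof. exact: le_normcD. Qed.

Lemma absCN z : absC (- z) = absC z.
Proof. exact: normcN. Qed.

Lemma absCB z w : absC (z - w) <= absC z + absC w.
Proof. by rewrite -[absC w]absCN absCD. Qed.

Lemma absCM z w : absC (z * w) = absC z * absC w.
Proof. exact: ComplexField.Normc.normcM. Qed.

Lemma absC_real (r : R) : absC r%:C%C = `|r|.
Proof. by rewrite absCE /= expr0n addr0 sqrtr_sqr. Qed.

Lemma cReB z w : Re (z - w) = Re z - Re w. Proof. by case: z; case: w. Qed.
Lemma cImB z w : Im (z - w) = Im z - Im w. Proof. by case: z; case: w. Qed.
Lemma cReM z w : Re (z * w) = Re z * Re w - Im z * Im w.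
Proof. by case: z; case: w. Qed.
Lemma cImM z w : Im (z * w) = Re z * Im w + Im z * Re w.
Proof. by case: z; case: w. Qed.

Lemma complex_eq z w : Re z = Re w -> Im z = Im w -> z = w.
Proof. by case: z; case: w => ? ? ? ? /= -> ->. Qed.

End modulus.

Section monotone.
Context d (T : measurableType d) (R : realType) (m : {measure set T -> \bar R}).
Local Open Scope ereal_scope.

(** The integral of a nonnegative function is a supremum over the simple functions below it, which
    gives monotonicity for arbitrary functions and domains. This allows a comparison with the size
    and Hormander integrals as they stand. *)
Lemma le_integral_sub (A B : set T) (f g : T -> \bar R) : A `<=` B ->
  (forall x, A x -> 0 <= f x <= g x) -> (forall x, B x -> 0 <= g x) ->
  \int[m]_(x in A) f x <= \int[m]_(x in B) g x.
Proof.
move=> AB fg g0; rewrite !ge0_integralE//; last first.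
  by move=> x /fg/andP[].
apply: le_ereal_sup => _ [h hf <-]; exists h => //= x.
rewrite (le_trans (hf x))// /patch; case: ifPn => [|_].
  by rewrite inE => Ax; rewrite ifT ?inE//; [have /andP[] := fg x Ax|exact: AB].
by case: ifPn => //; rewrite inE => /g0.
Qed.

Lemma ereal_sup_lty (X : set \bar R) : ereal_sup X < +oo ->
  exists2 c : R, (0 <= c)%R & forall x, X x -> x <= c%:E.
Proof.
move=> Xoo; exists (Num.max 0 (fine (ereal_sup X)))%R; first by rewrite le_max lexx.
move=> x Xx; rewrite (le_trans (ereal_sup_ubound Xx))//.
move: Xoo; case: (ereal_sup X) => [r _|//|_]; last by rewrite leNye.
by rewrite lee_fin le_max lexx orbT.
Qed.

End monotone.

Section complex_valued.
Context d (T : measurableType d) (R : realType) (m : {measure set T -> \bar R}).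
Implicit Types (D : set T) (f g : T -> R[i]).
Local Open Scope ereal_scope.

Lemma measurable_absC D f : cmeasurable D f -> measurable_fun D (fun x => absC (f x)).
Proof.
move=> [mr mi]; under eq_fun do rewrite absCE.
have msqrt : measurable_fun [set: R] Num.sqrt.
  by apply: continuous_measurable_fun; exact: sqrt_continuous.
apply: (measurableT_comp msqrt).
by apply: measurable_funD; exact: measurable_funX.
Qed.

Lemma cintegrable_cmeasurable D f : cintegrable m D f -> cmeasurable D f.
Proof.
by move=> [/measurable_int/measurable_EFinP ? /measurable_int/measurable_EFinP ?].
Qed.

Lemma cmeasurableB D f g : cmeasurable D f -> cmeasurable D g ->
  cmeasurable D (fun x => f x - g x)%R.
Proof.
move=> [fr fi] [gr gi]; split; under eq_fun do rewrite ?cReB ?cImB.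
  exact: measurable_funB.
exact: measurable_funB.
Qed.

Lemma cmeasurableM D f g : cmeasurable D f -> cmeasurable D g ->
  cmeasurable D (fun x => f x * g x)%R.
Proof.
move=> [fr fi] [gr gi]; split; under eq_fun do rewrite ?cReM ?cImM.
  by apply: measurable_funB; exact: measurable_funM.
by apply: measurable_funD; exact: measurable_funM.
Qed.

Lemma cintegrable_absC D f : measurable D -> cintegrable m D f ->
  \int[m]_(x in D) (absC (f x))%:E < +oo.
Proof.
move=> mD fi; have [fr fI] := fi; have [mr mi] := cintegrable_cmeasurable fi.
apply: (@le_lt_trans _ _
  (\int[m]_(x in D) (`|Re (f x)|%:E + `|Im (f x)|%:E))).
  by apply: le_integral_sub => // x _; rewrite -EFinD !lee_fin ?absC_ge0 ?absC_le// addr_ge0.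
rewrite ge0_integralD//=.
- by rewrite lte_add_pinfty//; [case/integrableP : fr|case/integrableP : fI].
- by apply/measurable_EFinP; exact: measurableT_comp.
- by apply/measurable_EFinP; exact: measurableT_comp.
Qed.

Lemma absC_cintegrable D f : measurable D -> cmeasurable D f ->
  \int[m]_(x in D) (absC (f x))%:E < +oo -> cintegrable m D f.
Proof.
move=> mD [mr mi] foo; split; apply/integrableP; split; do ?exact/measurable_EFinP;
  apply: le_lt_trans foo; apply: le_integral_sub => // x _ /=;
  by rewrite !lee_fin ?absC_ge0// normr_ge0 ?normRe_le ?normIm_le.
Qed.

(* The factor 2 comes from integrating real and imaginary parts separately. *)
Lemma absC_cintegral_le D f : measurable D -> cmeasurable D f ->
  (absC (cintegral m D f))%:E <= 2%:E * \int[m]_(x in D) (absC (f x))%:E.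
Proof.
move=> mD [mr mi].
have le_part (g : T -> R) : measurable_fun D g -> (forall x, `|g x| <= absC (f x))%R ->
    (`|\int[m]_(x in D) g x|)%:E <= \int[m]_(x in D) (absC (f x))%:E.
  move=> mg gf; apply: (@le_trans _ _ `|\int[m]_(x in D) (g x)%:E|).
    rewrite /Rintegral; case: (\int[m]_(x in D) (g x)%:E) => [r| |] //=;
    by rewrite normr0 leey.
  rewrite (le_trans (le_abse_integral _ _ _))//; first exact/measurable_EFinP.
  by apply: le_integral_sub => // x _; rewrite /= !lee_fin ?absC_ge0// normr_ge0 gf.
apply: (@le_trans _ _ ((`|\int[m]_(x in D) Re (f x)|)%:E + (`|\int[m]_(x in D) Im (f x)|)%:E)).
  by rewrite -EFinD lee_fin; exact: absC_le.
rewrite (_ : 2%:E = 1 + 1)// ge0_muleDl// !mul1e leeD// le_part// => x.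
  exact: normRe_le.
exact: normIm_le.
Qed.

Lemma cintegralB D f g : measurable D -> cintegrable m D f -> cintegrable m D g ->
  cintegral m D (fun x => f x - g x)%R = (cintegral m D f - cintegral m D g)%R.
Proof.
move=> mD [fr fi] [gr gi]; apply: complex_eq; rewrite ?cReB ?cImB /=.
  by rewrite -RintegralB//; apply: eq_Rintegral => x _; rewrite cReB.
by rewrite -RintegralB//; apply: eq_Rintegral => x _; rewrite cImB.
Qed.

Lemma eq_cintegral D f g : {in D, f =1 g} -> cintegral m D f = cintegral m D g.
Proof.
by move=> fg; apply: complex_eq; apply: eq_Rintegral => x /fg ->.
Qed.

Lemma cintegral_mkcond D f g : (forall x, D x -> g x = f x) ->
  (forall x, ~ D x -> g x = 0%R) -> cintegral m setT g = cintegral m D f.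
Proof.
move=> gf g0; apply: complex_eq => /=; rewrite [RHS]Rintegral_mkcond;
  apply: eq_Rintegral => x _; rewrite patchE; case: ifPn => [|].
- by rewrite inE => /gf ->.
- by rewrite notin_setE => /g0 ->.
- by rewrite inE => /gf ->.
- by rewrite notin_setE => /g0 ->.
Qed.

End complex_valued.

(** * Sections, Fubini and Tonelli on rectangles *)

Section rectangles.
Context d1 d2 (T1 : measurableType d1) (T2 : measurableType d2) (R : realType).
Context (m1 : {sigma_finite_measure set T1 -> \bar R}).
Context (m2 : {sigma_finite_measure set T2 -> \bar R}).
Context (A : set T1) (B : set T2) (mA : measurable A) (mB : measurable B).

Section measurability.
Context d (U : measurableType d).

Lemma measurable_section1 (g : T1 * T2 -> U) x : A x ->
  measurable_fun (A `*` B) g -> measurable_fun B (fun y => g (x, y)).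
Proof.
move=> Ax mg _ Y mY.
have := measurable_xsection x (mg (measurableX mA mB) Y mY).
congr (measurable _); apply/seteqP; split => y; rewrite /xsection/= inE.
  by move=> [[]].
by move=> [].
Qed.

Lemma measurable_fun_fst (g : T1 -> U) :
  measurable_fun A g -> measurable_fun (A `*` B) (fun z => g z.1).
Proof.
move=> mg _ Y mY; have := measurableX (mg mA Y mY) mB.
by congr (measurable _); apply/seteqP; split => z /=; tauto.
Qed.

Lemma measurable_fun_snd (g : T2 -> U) :
  measurable_fun B g -> measurable_fun (A `*` B) (fun z => g z.2).
Proof.
move=> mg _ Y mY; have := measurableX mA (mg mB Y mY).
by congr (measurable _); apply/seteqP; split => z /=; tauto.
Qed.

End measurability.

Local Open Scope ereal_scope.

(** Extending by zero off a rectangle amounts to extending by zero in each variable in turn, which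
    reduces statements on rectangles to those on the whole product. *)
Lemma patch_rectangle (g : T1 * T2 -> \bar R) x y :
  (g \_ (A `*` B)) (x, y) = ((fun x => ((fun y => g (x, y)) \_ B) y) \_ A) x.
Proof.
rewrite !patchE; have [xA|xA] := boolP (x \in A); have [yB|yB] := boolP (y \in B).
- by rewrite ifT// inE/=; split; exact: set_mem.
- by rewrite ifF//; apply/negbTE; rewrite notin_setE/= => -[_ /mem_set]; exact/negP.
- by rewrite ifF//; apply/negbTE; rewrite notin_setE/= => -[/mem_set + _]; exact/negP.
- by rewrite ifF//; apply/negbTE; rewrite notin_setE/= => -[_ /mem_set]; exact/negP.
Qed.

Lemma integrable_section1 (g : T1 * T2 -> \bar R) :
  (m1 \x m2).-integrable (A `*` B) g ->
  {ae m1, forall x, A x -> m2.-integrable B (fun y => g (x, y))}.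
Proof.
move=> /(integrable_mkcond _ (measurableX mA mB))/ae_integrable1.
apply: filterS => x + Ax; rewrite (_ : (fun y => _) = (fun y => g (x, y)) \_ B).
  by move=> /(integrable_mkcond _ mB).
by apply/funext => y; rewrite patch_rectangle patchE mem_set.
Qed.

Lemma integrable_section2 (g : T1 * T2 -> \bar R) :
  (m1 \x m2).-integrable (A `*` B) g ->
  {ae m2, forall y, B y -> m1.-integrable A (fun x => g (x, y))}.
Proof.
move=> /(integrable_mkcond _ (measurableX mA mB))/ae_integrable2.
apply: filterS => y + By; rewrite (_ : (fun x => _) = (fun x => g (x, y)) \_ A).
  by move=> /(integrable_mkcond _ mA).
apply/funext => x; rewrite patch_rectangle !patchE; case: ifP => // _.
by rewrite mem_set.
Qed.

Lemma tonelli_rectangle (g : T1 * T2 -> \bar R) :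
  measurable_fun (A `*` B) g -> (forall x y, A x -> B y -> 0 <= g (x, y)) ->
  \int[m1]_(x in A) \int[m2]_(y in B) g (x, y) =
  \int[m2]_(y in B) \int[m1]_(x in A) g (x, y).
Proof.
move=> mg g0; have mAB := measurableX mA mB.
have := @fubini_tonelli _ _ _ _ _ m1 m2 (g \_ (A `*` B)).
rewrite (_ : \int[m1]_x _ = \int[m1]_(x in A) \int[m2]_(y in B) g (x, y)); last first.
  rewrite [RHS]integral_mkcond; apply: eq_integral => x _; rewrite patchE.
  case: ifPn => [xA|xA].
    rewrite [RHS]integral_mkcond; apply: eq_integral => y _.
    by rewrite patch_rectangle patchE xA.
  rewrite integral0_eq// => y _; rewrite patch_rectangle patchE ifF//.
  exact/negbTE.
rewrite (_ : \int[m2]_y _ = \int[m2]_(y in B) \int[m1]_(x in A) g (x, y)); last first.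
  rewrite [RHS]integral_mkcond; apply: eq_integral => y _; rewrite patchE.
  case: ifPn => [yB|yB].
    rewrite [RHS]integral_mkcond; apply: eq_integral => x _.
    by rewrite patch_rectangle !patchE; case: ifP => // _; rewrite yB.
  rewrite integral0_eq// => x _; rewrite patch_rectangle !patchE.
  by case: ifP => // _; rewrite (negbTE yB).
apply; first by apply/(measurable_restrictT _ mAB).
by move=> [x y]; rewrite patchE; case: ifPn => //; rewrite inE => -[] /g0; exact.
Qed.

End rectangles.

(** * Kernels off the diagonal *)

Section geometry.
Context {R : realType} {n : nat}.
Local Notation V := 'rV[R]_n.
Implicit Types (a b x y : V) (l t d : R).

Lemma enorm_le x d : 0 <= d -> (forall i, `|x 0 i| <= d) ->
  enorm x <= Num.sqrt n%:R * d.
Proof.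
move=> d0 xd; rewrite -[d]ger0_norm// -sqrtr_sqr -sqrtrM ?ler0n// ler_wsqrtr//.
rewrite -[n in leRHS]card_ord mulr_natl -sumr_const ler_sum// => i _.
by rewrite -[leLHS]ger0_norm ?sqr_ge0// normrX ler_sqr ?nnegrE.
Qed.

Lemma enorm_ge x d : 0 <= d -> (forall i, d <= `|x 0 i|) ->
  Num.sqrt n%:R * d <= enorm x.
Proof.
move=> d0 xd; rewrite -[d]ger0_norm// -sqrtr_sqr -sqrtrM ?ler0n// ler_wsqrtr//.
rewrite -[n in leLHS]card_ord mulr_natl -sumr_const ler_sum// => i _.
by rewrite -[leRHS]ger0_norm ?sqr_ge0// normrX ler_sqr ?nnegrE.
Qed.

Lemma enorm_coord x i : `|x 0 i| <= enorm x.
Proof.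
rewrite -sqrtr_sqr ler_wsqrtr// (bigD1 i)//= lerDl sumr_ge0// => j _.
exact: sqr_ge0.
Qed.

(* Since [2 * n >= 2 * sqrt n], Hormander's condition applies on the far set to
   any two points of the cube. *)
Definition far a l : set V :=
  [set y | exists i, ~~ (a 0 i - (2 * n)%:R * l < y 0 i < a 0 i + (2 * n).+1%:R * l)].

Lemma far_separated a l x x' y : 0 < l -> ccube a l x -> ccube a l x' ->
  far a l y -> 2 * enorm (x - x') <= enorm (x - y).
Proof.
move=> l0 xa xa' [i yi].
have nl0 : 0 <= n%:R * l by rewrite mulr_ge0// ltW.
have -> : 2 * enorm (x - x') = enorm (x - x') + enorm (x - x') by ring.
have le_diam : enorm (x - x') <= n%:R * l.
  apply: (@le_trans _ _ (Num.sqrt n%:R * l)).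
    apply: enorm_le => [|j]; first exact: ltW.
    rewrite !mxE ler_norml; have /andP[? ?] := xa j; have /andP[? ?] := xa' j.
    by apply/andP; split; lra.
  rewrite ler_wpM2r ?(ltW l0)//.
  rewrite -[leRHS]ger0_norm// -sqrtr_sqr ler_wsqrtr// -natrX ler_nat.
  by case: (n) => // k; rewrite -mulnn leq_pmull.
rewrite (le_trans (lerD le_diam le_diam))//.
rewrite (le_trans _ (enorm_coord (x - y) i))// !mxE.
have /andP[? ?] := xa i; move: yi; rewrite negb_and -!leNgt -[(2 * n).+1%:R]natr1 natrM.
by move=> /orP[] ?; rewrite ler_normr; apply/orP; [left|right]; lra.
Qed.

Lemma near_ccube a l :
  ~` far a l `<=` ccube (a - const_mx ((2 * n)%:R * l)) ((4 * n).+1%:R * l).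
Proof.
move=> y /forallNP yf i; have /negP := yf i; rewrite negbK => /andP[y1 y2].
rewrite !mxE; move: y1 y2; rewrite -[(4 * n).+1%:R]natr1 -[(2 * n).+1%:R]natr1 !natrM.
by move=> y1 y2; apply/andP; split; lra.
Qed.

Lemma far_ccube_disjoint a l : (0 < n)%N -> 0 < l -> ccube a l `&` far a l = set0.
Proof.
move=> n0 l0; apply/seteqP; split => // y [ya [i /negP]]; apply.
have /andP[y1 y2] := ya i.
have n1 : (1 <= n%:R :> R) by rewrite ler1n.
have nl : l <= n%:R * l by rewrite ler_peMl// ltW.
by rewrite -[(2 * n).+1%:R]natr1 natrM; apply/andP; split; lra.
Qed.

Lemma closed_far a l : closed (far a l).
Proof.
pose I i : set R := `]a 0 i - (2 * n)%:R * l, a 0 i + (2 * n).+1%:R * l[%classic.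
rewrite (_ : far a l = \bigcup_(i in [set: 'I_n]) (fun y : V => y 0 i) @^-1` (~` I i)).
  apply: closed_bigcup => [|i _]; first exact: finite_finset.
  apply: preimage_closed => [y _|]; last exact/open_closedC/itv_open.
  exact: coord_continuous.
apply/seteqP; split => y [i yi0]; last move=> yI.
  by exists i => // -[]; rewrite /I /= in_itv/=; exact/negP.
by exists i; apply/negP => yi; apply: yI; rewrite /I /= in_itv.
Qed.

Lemma measurable_far a l : measurable (far a l).
Proof.
rewrite (_ : far a l = ~` \bigcap_(i in [set: 'I_n])
    ([set y : V | y 0 i < a 0 i + (2 * n).+1%:R * l] `\`
     \bigcap_k [set y : V | y 0 i < a 0 i - (2 * n)%:R * l + k.+1%:R^-1])).
  apply: measurableC; apply: fin_bigcap_measurable => [|i _]; first exact: finite_finset.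
  apply: measurableD; first exact: measurable_halfspace.
  by apply: bigcap_measurable => [|k _]; [exists 0%N|exact: measurable_halfspace].
apply/seteqP; split => y.
  move=> [i /negP yi] /(_ i I)[/= yi2] yi1; apply: yi; rewrite yi2 andbT ltNge.
  apply/negP => yi; apply: yi1 => k _ /=.
  by rewrite (le_lt_trans yi)// ltrDl invr_gt0.
move=> nI; apply: contrapT => /forallNP nfar; apply: nI => i _.
have /negP := nfar i; rewrite negbK => /andP[y1 y2]; split => //= yi.
have : y 0 i <= a 0 i - (2 * n)%:R * l.
  apply/ler_addgt0Pr => e e0; have /= /ltW/le_trans := yi (Num.truncn e^-1) I; apply.
  by rewrite lerD2l invf_ple ?posrE// ltW// truncnS_gt.
by rewrite leNgt y1.
Qed.

End geometry.

Section indicator.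
Context {R : realType} {n : nat}.
Local Notation V := 'rV[R]_n.
Local Notation mu := (@lebesgue_rV R n).
Implicit Types (f : V -> R[i]) (F B : set V).

Definition cindic F : V -> R[i] := fun x => (\1_F x)%:C%C.

Lemma cindic_in F x : F x -> cindic F x = 1.
Proof. by move=> Fx; rewrite /cindic indicE mem_set. Qed.

Lemma cindic_notin F x : ~ F x -> cindic F x = 0.
Proof. by move=> Fx; rewrite /cindic indicE memNset. Qed.

Lemma supp_sub f B : closed B -> (forall x, f x != 0 -> B x) -> supp f `<=` B.
Proof.
move=> cB fB; rewrite [X in _ `<=` X](closure_id B).1//.
by apply: closure_subset => x /fB.
Qed.

Lemma compact_supp_sub f B : compact B -> (forall x, f x != 0 -> B x) -> compact (supp f).
Proof.
move=> cB fB; apply: (subclosed_compact _ cB); first exact: closed_closure.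
by apply: supp_sub => //; apply: compact_closed => //; exact: norm_hausdorff.
Qed.

Lemma cindic_neq0 F x : cindic F x != 0 -> F x.
Proof. by move=> /eqP Fx; apply: contrapT => /cindic_notin. Qed.

Lemma bounded_compact_supp_cindic F B : measurable F -> compact B -> F `<=` B ->
  bounded_compact_supp (cindic F).
Proof.
move=> mF cB FB; split.
- by split; [exact: measurable_indic|exact: measurable_cst].
- apply: (@le_lt_trans _ _ 1%:E); last exact: ltry.
  by apply/ess_supP; apply: nearW => x; rewrite lee_fin absC_real ger0_norm//.
- by apply: (compact_supp_sub cB) => x /cindic_neq0 /FB.
Qed.

End indicator.

Section kernel.
Context {R : realType} {n : nat}.
Local Notation V := 'rV[R]_n.
Local Notation mu := (@lebesgue_rV R n).
Context (T : operator R n).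
Let K := op_kernel T.
Implicit Types (A B F : set V) (x y a : V) (l : R).
Local Open Scope ereal_scope.

Context (kernelT : has_kernel T).

Lemma kernel_rectangle A B : compact A -> compact B -> A `&` B = set0 ->
  cintegrable (mu \x mu) (A `*` B) (fun z => K z.1 z.2).
Proof.
move=> cA cB AB; apply: kernelT.1; first exact: compact_setX.
move=> [x y] [/= Ax By]; apply/eqP => xy; have : (A `&` B) x by split => //; rewrite xy.
by rewrite AB.
Qed.

Context (A B : set V) (cA : compact A) (cB : compact B) (AB : A `&` B = set0).
Context (mA : measurable A) (mB : measurable B).

(** Integrability of sections holds almost everywhere, but measurability at every point of [A],
    hence also at a point fixed in advance such as the corner of the cube of an atom. *)
Lemma cmeasurable_kernel1 x : A x -> cmeasurable B (fun y => K x y).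
Proof.
move=> Ax; have [mr mi] := cintegrable_cmeasurable (kernel_rectangle cA cB AB).
split; first exact: (measurable_section1 mA mB Ax mr).
exact: (measurable_section1 mA mB Ax mi).
Qed.

Lemma cintegrable_kernel1 :
  {ae mu, forall x, A x -> cintegrable mu B (fun y => K x y)}.
Proof.
have [ir ii] := kernel_rectangle cA cB AB.
have := integrable_section1 mA mB ir; have := integrable_section1 mA mB ii.
by apply: filterS2 => x Hi Hr Ax; split; [exact: Hr|exact: Hi].
Qed.

Lemma cintegrable_kernel2 :
  {ae mu, forall y, B y -> cintegrable mu A (fun x => K x y)}.
Proof.
have [ir ii] := kernel_rectangle cA cB AB.
have := integrable_section2 mA mB ir; have := integrable_section2 mA mB ii.
by apply: filterS2 => x Hi Hr Ax; split; [exact: Hr|exact: Hi].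
Qed.

(** The closed set [B] contains the support of [cindic F], so that the points of [A] are off this
    support. *)
Lemma op_fun_cindic F : extends_to_bounded T -> measurable F -> F `<=` B ->
  {ae mu, forall x, A x -> op_fun T (cindic F) x = cintegral mu F (fun y => K x y)}.
Proof.
move=> eT mF FB.
have := ext_kernel eT (bounded_compact_supp_cindic mF cB FB).
apply: filterS => x Tx Ax; rewrite Tx; last first.
  have cB' : closed B by apply: compact_closed => //; exact: norm_hausdorff.
  move=> /(supp_sub cB') Bx; have : (A `&` B) x.
    by split => //; apply: Bx => y /cindic_neq0 /FB.
  by rewrite AB.
apply: cintegral_mkcond => y Fy; first by rewrite cindic_in// mulr1.
by rewrite cindic_notin// mulr0.
Qed.

End kernel.

Section shifted_cube.
Context {R : realType} {n : nat} (n_gt0 : (0 < n)%N).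
Local Notation V := 'rV[R]_n.
Local Notation mu := (@lebesgue_rV R n).
Context (T : operator R n) (kernelT : has_kernel T) (eT : extends_to_bounded T).
Let K := op_kernel T.
Implicit Types (a x y : V) (l : R).
Local Open Scope ereal_scope.

Context (Z : R) (sizeT : forall x (r : R), (0 < r)%R ->
  \int[mu]_(y in [set y : V | (r <= enorm (x - y) <= 2 * r)%R])
     (absC (K x y) + absC (K y x))%:E <= Z%:E).

(* For [l' <= l] the shift by [3 * l] puts the cube in the annulus
   [r <= |x - y| <= 2 * r], [r = 2 * sqrt n * l], around each [x] in [ccube a l]. *)
Definition shifted_cube a l (l' : R) : set V := ccube (a + const_mx (3 * l))%R l'.

Lemma shifted_cube_disjoint a l l' : (0 < l)%R -> ccube a l `&` shifted_cube a l l' = set0.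
Proof.
move=> l0; apply/seteqP; split => // x [xa xG].
have /andP[_ x1] := xa (Ordinal n_gt0); have := xG (Ordinal n_gt0).
by rewrite !mxE => /andP[x2 _]; exfalso; lra.
Qed.

Lemma op_fun_shifted_cube a l l' : (0 < l)%R -> (l' <= l)%R ->
  {ae mu, forall x, ccube a l x ->
    (absC (op_fun T (cindic (shifted_cube a l l')) x) <= 2 * Z)%R}.
Proof.
move=> l0 l'l; have dis := shifted_cube_disjoint a l' l0.
have mH := measurable_ccube a l; have mG := measurable_ccube (a + const_mx (3 * l))%R l'.
have cH := @compact_ccube _ _ a l; have cG := @compact_ccube _ _ (a + const_mx (3 * l))%R l'.
have := op_fun_cindic cG dis eT mG (@subset_refl V _).
apply: filterS => x Tx xa; rewrite Tx//.
have mK := cmeasurable_kernel1 kernelT cH cG dis mH mG xa.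
rewrite -lee_fin (le_trans (absC_cintegral_le mu mG mK))// EFinM lee_wpmul2l//.
have sn0 : (0 < Num.sqrt n%:R :> R)%R by rewrite sqrtr_gt0 ltr0n.
have r0 : (0 < 2 * Num.sqrt n%:R * l)%R by rewrite !mulr_gt0.
apply: le_trans (sizeT x r0); apply: le_integral_sub.
- move=> y yG /=; have l20 : (0 <= 2 * l)%R by rewrite mulr_ge0// ltW.
  have l40 : (0 <= 4 * l)%R by rewrite mulr_ge0// ltW.
  have coord i : (2 * l <= - (x - y) 0 i <= 4 * l)%R.
    rewrite !mxE; have := xa i; have := yG i; rewrite !mxE => /andP[? ?] /andP[? ?].
    by apply/andP; split; lra.
  have le1 := @enorm_ge _ _ (x - y)%R _ l20; have le2 := @enorm_le _ _ (x - y)%R _ l40.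
  apply/andP; split.
    rewrite (le_trans _ (le1 _))//; first by lra.
    by move=> i; rewrite -normrN ler_normr; have /andP[-> _] := coord i.
  rewrite (le_trans (le2 _))//; last by lra.
  move=> i; rewrite -normrN ler_norml; have /andP[? ?] := coord i.
  by apply/andP; split; lra.
- by move=> y _; rewrite !lee_fin absC_ge0/= lerDl absC_ge0.
- by move=> y _; rewrite lee_fin addr_ge0 ?absC_ge0.
Qed.

End shifted_cube.

(** * Local estimates on indicator functions *)

Section local_estimates.
Context {R : realType} {n : nat} (n_gt0 : (0 < n)%N).
Local Notation V := 'rV[R]_n.
Local Notation mu := (@lebesgue_rV R n).
Context (hmass_gt0 : (0 < @hmass R n)%R).
Context (T : operator R n) (kernelT : has_kernel T) (eT : extends_to_bounded T).
Let K := op_kernel T.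
Implicit Types (a b x y : V) (l L : R) (F G : set V).
Local Open Scope ereal_scope.

Context (Z : R) (Z_ge0 : (0 <= Z)%R) (sizeT : forall x (r : R), (0 < r)%R ->
  \int[mu]_(y in [set y : V | (r <= enorm (x - y) <= 2 * r)%R])
     (absC (K x y) + absC (K y x))%:E <= Z%:E).
Context (A0 : R) (A0_ge0 : (0 <= A0)%R) (weakT : forall f, A01 f ->
  forall t : R, (0 < t)%R -> t%:E * mu [set x | (t < absC (op_fun T f x))%R] <= A0%:E).

Let cmass_gt0 : (0 < @cmass R n)%R.
Proof. exact: lt_le_trans (hmass_cmass). Qed.

(** Provides the side of a cube of prescribed measure. *)
Lemma exists_root (r : R) : (0 < r)%R -> exists2 t : R, (0 < t)%R & (t ^+ n = r)%R.
Proof.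
move=> r0; exists (r `^ (n%:R^-1))%R; first exact: powR_gt0.
rewrite -powR_mulrn ?powR_ge0// -powRrM mulVf ?pnatr_eq0 -?lt0n// powRr1// ltW//.
Qed.

(** Positivity of [mu F] makes the companion cube [G] of the same measure nondegenerate. As
    [cindic F - cindic G] is [v] times the atom [b], the weak-type bound is used at level [w / v],
    where it gives measure at most [A0 * v / w]. *)
Let local_weak_pos (th : R) a l F : (0 < th)%R -> (0 < l)%R ->
  measurable F -> F `<=` ccube a l -> 0 < mu F ->
  mu (ccube a l `&`
      [set x | (2 * Z + (A0 * 4 ^+ n / th + 1) < absC (op_fun T (cindic F) x))%R]) <=
  th%:E * mu (ccube a l).
Proof.
(* [v] is [4 ^+ n] times the measure of [ccube a l], so that [A0 * v / w] is at most [th] times that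
   measure; the summand 1 keeps [w] positive if [A0 = 0]. *)
move=> th0 l0 mF FH F0; set w := (A0 * 4 ^+ n / th + 1)%R.
have w0 : (0 < w)%R by rewrite ltr_wpDl// divr_ge0 ?mulr_ge0 ?exprn_ge0// ltW.
have [f Ff] : exists f : R, mu F = f%:E.
  exists (fine (mu F)); rewrite fineK// ge0_fin_numE//.
  exact: le_lt_trans (le_mu FH) (mu_ccube_lty a l).
move: F0; rewrite Ff lte_fin => f0.
have [l' l'0 l'n] := exists_root (divr_gt0 f0 cmass_gt0).
have muG b : mu (ccube b l') = mu F.
  by rewrite mu_ccube// l'n Ff divfK// gt_eqF.
have l'l : (l' <= l)%R.
  rewrite -(ler_pXn2r n_gt0) ?nnegrE ?(ltW l'0) ?(ltW l0)// l'n ler_pdivrMr//.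
  by rewrite -lee_fin -Ff -(mu_ccube a)//; exact: le_mu.
(* Side [4 * l] has room for [ccube a l] and for the companion, which begins at [3 * l] and has side
   at most [l]. *)
pose G := shifted_cube a l l'; pose E := ccube a (4 * l)%R.
have l40 : (0 < 4 * l)%R by rewrite mulr_gt0.
pose v := vol E.
have vE : v = (4 ^+ n * (l ^+ n * @cmass R n))%R.
  by rewrite /v/vol/E mu_ccube//= exprMn mulrA.
have v0 : (0 < v)%R by rewrite vE !mulr_gt0// exprn_gt0.
have GE : G `<=` E.
  move=> x xG i; have := xG i; rewrite !mxE => /andP[? ?].
  by apply/andP; split; lra.
have HE : ccube a l `<=` E.
  by move=> x xH i; have /andP[? ?] := xH i; apply/andP; split; lra.
have FG0 := shifted_cube_disjoint n_gt0 a l' l0.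
pose b : V -> R[i] := fun x => (v^-1 * (\1_F x - \1_G x))%:C%C.
have mG : measurable G by exact: measurable_ccube.
have cE : compact E by exact: compact_ccube.
have Ab : A01 b.
  exists E; first by exists a, (4 * l)%R.
  exists G, (ccube a l), F; split => //.
  - by split; [exists (a + const_mx (3 * l))%R, l'|exists a, l].
  - by rewrite setIC.
  - by split => //; rewrite /G muG.
have bb : bounded_compact_supp b.
  split.
  - split; last exact: measurable_cst.
    apply: measurable_funM; first exact: measurable_cst.
    by apply: measurable_funB; exact: measurable_indic.
  - apply: (@le_lt_trans _ _ (v^-1 * 1)%:E); last exact: ltry.
    apply/ess_supP; apply: nearW => x; rewrite lee_fin absC_real normrM.
    apply: ler_pM => //; first by rewrite ger0_norm ?invr_ge0 ?(ltW v0).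
    rewrite !indicE ler_norml.
    by case: (x \in F); case: (x \in G) => /=; apply/andP; split; lra.
  - apply: (compact_supp_sub cE) => x bx; apply: contrapT => xE.
    move: bx; rewrite /b !indicE !memNset ?subrr ?mulr0 ?eqxx//.
      by move=> /GE.
    by move=> /FH /HE.
have bG : bounded_compact_supp (cindic G) by exact: bounded_compact_supp_cindic GE.
have FbG : cindic F = (fun y => v%:C%C * b y + cindic G y)%R.
  apply/funext => y; rewrite /b /cindic; apply: complex_eq.
    by rewrite /= mul0r subr0 mulrA divff ?gt_eqF// mul1r subrK.
  by rewrite /= !mul0r mulr0 !addr0.
have := ext_linear eT v%:C%C bb bG; rewrite -FbG => TF.
have TG := op_fun_shifted_cube n_gt0 kernelT eT sizeT a l0 l'l.
have sub : {ae mu, forall x, (ccube a l `&`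
      [set x | (2 * Z + w < absC (op_fun T (cindic F) x))%R]) x ->
      [set x | (w / v < absC (op_fun T b x))%R] x}.
  move: TF TG; apply: filterS2 => x TF TG [xH /=]; rewrite TF => big.
  have := absCD (v%:C%C * op_fun T b x)%R (op_fun T (cindic G) x).
  have := TG xH; rewrite absCM absC_real ger0_norm ?(ltW v0)// ltr_pdivrMr//.
  by rewrite -/G mulrC; lra.
rewrite (le_trans (mu_ae_le sub))//.
have wv0 : (0 < w / v)%R by rewrite divr_gt0.
have := weakT Ab wv0; rewrite -lee_pdivlMl// => /le_trans; apply.
rewrite mu_ccube// -!EFinM lee_fin invf_div -mulrA mulrC -mulrA.
rewrite ler_pdivrMl// vE.
set q := (l ^+ n * cmass)%R.
have q0 : (0 <= q)%R by rewrite mulr_ge0 ?exprn_ge0// ltW.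
have -> : (w * (th * q) = (A0 * 4 ^+ n + th) * q)%R.
  by rewrite /w; field; rewrite gt_eqF.
by rewrite mulrA ler_wpM2r// lerDl ltW.
Qed.

Lemma local_weak (th : R) : (0 < th)%R -> exists2 s : R, (0 < s)%R &
  forall a l F, (0 < l)%R -> measurable F -> F `<=` ccube a l ->
    mu (ccube a l `&` [set x | (s < absC (op_fun T (cindic F) x))%R]) <=
    th%:E * mu (ccube a l).
Proof.
move=> th0; have th20 : (0 < th / 2)%R by rewrite divr_gt0.
(* The halved proportion and the doubled threshold serve the case of a null [F], which goes through
   two sets of positive measure. *)
set s := (2 * Z + (A0 * 4 ^+ n / (th / 2) + 1))%R.
have s0 : (0 < s)%R.
  rewrite ltr_wpDl ?mulr_ge0// ltr_wpDl// divr_ge0 ?mulr_ge0 ?exprn_ge0// ltW//.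
exists (2 * s)%R; first by rewrite mulr_gt0.
move=> a l F l0 mF FH; set H := ccube a l.
have mH : measurable H by exact: measurable_ccube.
have H0 : 0 < mu H by rewrite mu_ccube// lte_fin mulr_gt0// exprn_gt0.
have thE : th%:E * mu H = (th / 2)%:E * mu H + (th / 2)%:E * mu H.
  by rewrite /H mu_ccube// -!EFinM -EFinD; congr EFin; field.
have th2H : 0 <= (th / 2)%:E * mu H by rewrite mule_ge0// lee_fin ltW.
have [F0|F0] := eqVneq (mu F) 0; last first.
  rewrite (le_trans _ (le_trans (local_weak_pos th20 l0 mF FH _) _))//.
  - by apply: le_mu => x [xH /= xs]; split => //=; rewrite -/s; lra.
  - by rewrite lt0e F0 measure_ge0.
  - by rewrite thE leeDl.
(* [T] need not vanish on a null indicator function: write it as a difference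
   of indicator functions of sets of positive measure. *)
have mHF : measurable (H `\` F) by exact: measurableD.
have HFH : H `\` F `<=` H by move=> x [].
have HF0 : 0 < mu (H `\` F).
  rewrite (lt_le_trans H0)// (@le_trans _ _ (mu (F `|` (H `\` F))))//.
    by apply: le_mu => x xH; have [?|?] := pselect (F x); [left|right].
  by rewrite (le_trans (muU_le _ _))// -[leRHS]add0e leeD2r// F0.
have cH : compact H by exact: compact_ccube.
have bH := bounded_compact_supp_cindic mH cH (@subset_refl V H).
have bHF := bounded_compact_supp_cindic mHF cH HFH.
have FE : cindic F = (fun y => (-1) * cindic (H `\` F) y + cindic H y)%R.
  apply/funext => y; have [yF|yF] := pselect (F y).
    by rewrite (cindic_in yF) (cindic_in (FH _ yF)) cindic_notin ?mulr0 ?add0r// => -[].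
  rewrite cindic_notin//; have [yH|yH] := pselect (H y).
    by rewrite !cindic_in// mulr1 addrC subrr.
  by rewrite !cindic_notin ?mulr0 ?addr0// => -[].
have := ext_linear eT (-1)%R bHF bH; rewrite -FE => TF.
pose W G := H `&` [set x | (s < absC (op_fun T (cindic G) x))%R].
have sub : {ae mu, forall x,
    (H `&` [set x | (2 * s < absC (op_fun T (cindic F) x))%R]) x ->
    (W (H `\` F) `|` W H) x}.
  move: TF; apply: filterS => x TF [xH /=]; rewrite TF mulN1r => big.
  have := absCD (- op_fun T (cindic (H `\` F)) x)%R (op_fun T (cindic H) x).
  rewrite absCN => le_sum.
  have [xs|xs] := ltP s (absC (op_fun T (cindic H) x)); first by right.
  by left; split => //=; lra.
rewrite (le_trans (mu_ae_le sub))// (le_trans (muU_le _ _))// thE leeD//.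
  exact: local_weak_pos.
exact: local_weak_pos.
Qed.

End local_estimates.

(** * Oscillation on cubes and the resulting integral bound *)

Section local_oscillation.
Context {R : realType} {n : nat} (n_gt0 : (0 < n)%N).
Local Notation V := 'rV[R]_n.
Local Notation mu := (@lebesgue_rV R n).
Context (hmass_gt0 : (0 < @hmass R n)%R).
Context (T : operator R n) (kernelT : has_kernel T) (eT : extends_to_bounded T).
Let K := op_kernel T.
Implicit Types (a b x y : V) (l L : R) (F G : set V).
Local Open Scope ereal_scope.

Context (H0 : R) (H0_ge0 : (0 <= H0)%R) (hormanderT : forall x x',
  \int[mu]_(y in [set y : V | (enorm (x - y) >= 2 * enorm (x - x'))%R])
     (absC (K x y - K x' y) + absC (K y x - K y x'))%:E <= H0%:E).
Context (weak_small : forall th : R, (0 < th)%R -> exists2 s : R, (0 < s)%R &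
  forall a l F, (0 < l)%R -> measurable F -> F `<=` ccube a l ->
    mu (ccube a l `&` [set x | (s < absC (op_fun T (cindic F) x))%R]) <=
    th%:E * mu (ccube a l)).

Let mu_hcube_gt0 a l : (0 < l)%R -> 0 < mu (hcube a l).
Proof. by move=> l0; rewrite mu_hcube// lte_fin mulr_gt0// exprn_gt0. Qed.

(** The constant is the value at a single point [x0] where the kernel formula holds and converges
    absolutely; almost every point of the cube is of this kind, and the cube has positive measure.
    Hormander's condition compares the other good points with [x0]. *)
Let far_oscillation a l b L F : (0 < l)%R -> measurable F ->
  F `<=` ccube b L `&` far a l -> exists c : R[i],
  {ae mu, forall x, hcube a l x -> (absC (op_fun T (cindic F) x - c) <= 2 * H0)%R}.
Proof.
move=> l0 mF FB; set A := ccube a l; set B := ccube b L `&` far a l.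
have cA : compact A by exact: compact_ccube.
have cB : compact B.
  apply: (@subclosed_compact _ _ (ccube b L)); [|exact: compact_ccube|by move=> x []].
  by apply: closedI; [exact: closed_ccube|exact: closed_far].
have mA : measurable A by exact: measurable_ccube.
have mB : measurable B.
  by apply: measurableI; [exact: measurable_ccube|exact: measurable_far].
have AB : A `&` B = set0.
  by rewrite /B setICA (far_ccube_disjoint a n_gt0 l0) setI0.
have := op_fun_cindic cB AB eT mF FB.
have := cintegrable_kernel1 kernelT cA cB AB mA mB.
move=> iK TK; have good : {ae mu, forall x, A x ->
    cintegrable mu F (fun y => K x y) /\
    op_fun T (cindic F) x = cintegral mu F (fun y => K x y)}.
  move: iK TK; apply: filterS2 => x iK TK Ax; split; last exact: TK.
  by have [ir ii] := iK Ax; split; [exact: integrableS ir|exact: integrableS ii].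
have [x0 [x0Q [ix0 Tx0]]] : exists x0, hcube a l x0 /\
    (cintegrable mu F (fun y => K x0 y) /\
    op_fun T (cindic F) x0 = cintegral mu F (fun y => K x0 y)).
  apply: contrapT => /forallNP nogood.
  have : {ae mu, forall x, hcube a l x -> (set0 : set V) x}.
    move: good; apply: filterS => x gx xQ; apply: (nogood x); split => //.
    by apply: gx; exact: hcube_ccube.
  by move=> /mu_ae_le; rewrite measure0 leNgt mu_hcube_gt0.
exists (op_fun T (cindic F) x0).
move: good; apply: filterS => x gx xQ.
have xA : A x by exact: hcube_ccube.
have [ix Tx] := gx xA; rewrite Tx Tx0 -cintegralB// -lee_fin.
have mKx := cmeasurableB (cintegrable_cmeasurable ix) (cintegrable_cmeasurable ix0).
rewrite (le_trans (absC_cintegral_le mu mF mKx))// EFinM lee_wpmul2l//.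
apply: le_trans (hormanderT x x0); apply: le_integral_sub.
- by move=> y /FB[_ yf] /=; apply: far_separated yf => //; exact: hcube_ccube.
- by move=> y _; rewrite !lee_fin absC_ge0/= lerDl absC_ge0.
- by move=> y _; rewrite lee_fin addr_ge0 ?absC_ge0.
Qed.

(** It matters that [s] is chosen before [F], [b] and [L]: the cube [ccube b L] makes the far part
    of [F] bounded, so that the kernel formula applies, but its size does not enter the estimate. *)
Lemma local_oscillation (th : R) : (0 < th)%R -> exists2 s : R, (0 < s)%R &
  forall F b L, measurable F -> F `<=` ccube b L -> forall a l, (0 < l)%R ->
    exists c : R[i],
      mu (hcube a l `&` [set x | (s < absC (op_fun T (cindic F) x - c))%R]) <=
      th%:E * mu (hcube a l).
Proof.
(* The part of [F] near the cube lies in a closed cube of side [(4 * n).+1 * l]; the factor [2 ^+ n]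
   compares closed with half-open cubes. *)
move=> th0; pose M : R := ((4 * n).+1%:R ^+ n * 2 ^+ n)%R.
have M0 : (0 < M)%R by rewrite mulr_gt0 ?exprn_gt0.
have [s s0 weak_s] := weak_small (divr_gt0 th0 M0).
exists (s + 2 * H0)%R; first by rewrite ltr_wpDr// mulr_ge0.
move=> F b L mF FB a l l0.
set a' := (a - const_mx ((2 * n)%:R * l))%R; set l' := ((4 * n).+1%:R * l)%R.
have l'0 : (0 < l')%R by rewrite mulr_gt0.
pose F1 := F `\` far a l; pose F2 := F `&` far a l.
have mfar := measurable_far a l.
have mF1 : measurable F1 by exact: measurableD.
have mF2 : measurable F2 by exact: measurableI.
have F1Q : F1 `<=` ccube a' l' by move=> x [_]; exact: near_ccube.
have F2B : F2 `<=` ccube b L `&` far a l by move=> x [/FB].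
have [c osc] := far_oscillation l0 mF2 F2B; exists c.
have bF1 := bounded_compact_supp_cindic mF1 (@compact_ccube _ _ a' l') F1Q.
have F2b : F2 `<=` ccube b L by move=> x [/FB].
have bF2 := bounded_compact_supp_cindic mF2 (@compact_ccube _ _ b L) F2b.
have FE : cindic F = (fun y => 1 * cindic F1 y + cindic F2 y)%R.
  apply/funext => y; rewrite mul1r; have [yF|yF] := pselect (F y); last first.
    by rewrite !cindic_notin ?addr0// => -[].
  rewrite (cindic_in yF); have [yf|yf] := pselect (far a l y).
    by rewrite cindic_notin ?cindic_in ?add0r// => -[_].
  by rewrite cindic_in ?cindic_notin ?addr0// => -[].
have := ext_linear eT 1%R bF1 bF2; rewrite -FE => TF.
have sub : {ae mu, forall x,
    (hcube a l `&` [set x | (s + 2 * H0 < absC (op_fun T (cindic F) x - c))%R]) x ->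
    (ccube a' l' `&` [set x | (s < absC (op_fun T (cindic F1) x))%R]) x}.
  move: TF osc; apply: filterS2 => x TF osc [xQ /=]; rewrite TF mul1r -addrA => big.
  split.
    apply: near_ccube => xfar.
    have := far_ccube_disjoint a n_gt0 l0; apply/eqP/set0P; exists x.
    by split => //; exact: hcube_ccube.
  have := absCD (op_fun T (cindic F1) x) (op_fun T (cindic F2) x - c)%R.
  by have /= := osc xQ; lra.
rewrite (le_trans (mu_ae_le sub))// (le_trans (weak_s _ _ _ l'0 mF1 F1Q))//.
rewrite mu_ccube// mu_hcube// -!EFinM lee_fin /l' exprMn.
rewrite -[in leLHS]mulrA ler_wpM2l ?(ltW th0)//.
rewrite mulrC ler_pdivrMr// /M.
have := @cmass_hmass R n; set p := ((4 * n).+1%:R ^+ n)%R => cle.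
have p0 : (0 <= p)%R by rewrite exprn_ge0.
have l0n : (0 <= l ^+ n)%R by rewrite exprn_ge0// ltW.
have := ler_wpM2l (mulr_ge0 p0 l0n) cle.
by move=> /le_trans; apply; rewrite le_eqVlt; apply/orP; left; apply/eqP; ring.
Qed.

(** The oscillation controls the distance to a constant. That constant is bounded because [F] lies
    in the cube itself, where [weak_small] bounds [T chi_F] off a small proportion. *)
Lemma integral_op_fun_cindic : exists2 C : R, (0 <= C)%R &
  forall a l F, (0 < l)%R -> measurable F -> F `<=` hcube a l ->
  \int[mu]_(x in hcube a l) (absC (op_fun T (cindic F) x))%:E <=
  C%:E * mu (hcube a l).
Proof.
have p0 k : (0 < (2 ^+ k)^-1 :> R)%R by rewrite invr_gt0 exprn_gt0.
have [s s0 osc] := local_oscillation (p0 n.+3).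
(* The proportion 2^-(n+2) of the closed cube is at most 1/4 of the half-open one; with the 1/8 from
   the oscillation, points remain where both bounds hold. *)
have [s1 s10 weak1] := weak_small (p0 n.+2).
(* The deviations of the real and imaginary parts cost [8 * s] each, and the constant costs
   [2 * (s + s1)]. *)
exists (2 * (9 * s + s1))%R; first by rewrite mulr_ge0// addr_ge0// ?mulr_ge0// ltW.
move=> a l F l0 mF FQ.
have FB := subset_trans FQ (@hcube_ccube _ _ a l).
have := osc F a l mF FB; set f := op_fun T (cindic F) => oscF.
pose P (p : V * R) (c : R[i]) := (0 < p.2)%R ->
  mu (hcube p.1 p.2 `&` [set x | (s < absC (f x - c))%R]) <=
      ((2 ^+ n.+3)^-1)%:E * mu (hcube p.1 p.2).
(* Cubes of side at most 0, for which [P] is vacuous, receive the value 0. *)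
have [c Pc] : {c : V * R -> R[i] & forall p, P p (c p)}.
  apply: (@choice _ _ P) => -[a' l']; have [l'0|l'0] := pselect (0 < l')%R.
    by have [c] := oscF a' l' l'0; exists c.
  by exists 0%R => /l'0.
have [mr mi] := ext_measurable eT (bounded_compact_supp_cindic mF (@compact_ccube _ _ a l) FB).
set Q := hcube a l; have mQ : measurable Q by exact: measurable_hcube.
have jsr := @john_stromberg _ _ hmass_gt0 (fun x => Re (f x))
  (fun a l => Re (c (a, l))) s s0 mr _ a l l0.
have jsi := @john_stromberg _ _ hmass_gt0 (fun x => Im (f x))
  (fun a l => Im (c (a, l))) s s0 mi _ a l l0.
have {}jsr : \int[mu]_(x in Q) (`|Re (f x) - Re (c (a, l))|)%:E <= (8 * s)%:E * mu Q.
  apply: jsr => b t t0; apply: le_trans (Pc (b, t) t0); apply: le_mu => x [xQ /= xs].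
  by split => //=; rewrite (lt_le_trans xs)// -cReB normRe_le.
have {}jsi : \int[mu]_(x in Q) (`|Im (f x) - Im (c (a, l))|)%:E <= (8 * s)%:E * mu Q.
  apply: jsi => b t t0; apply: le_trans (Pc (b, t) t0); apply: le_mu => x [xQ /= xs].
  by split => //=; rewrite (lt_le_trans xs)// -cImB normIm_le.
have cle : (absC (c (a, l)) <= s + s1)%R.
  rewrite leNgt; apply/negP => cbig.
  have : mu Q <= mu (ccube a l `&` [set x | (s1 < absC (f x))%R]) +
      mu (Q `&` [set x | (s < absC (f x - c (a, l)))%R]).
    rewrite (le_trans _ (muU_le _ _))//; apply: le_mu => x xQ.
    have [fs|fs] := ltP s1 (absC (f x)); first by left; split => //; exact: hcube_ccube.
    right; split => //=; have := absCB (f x) (f x - c (a, l))%R.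
    by rewrite subKr; lra.
  apply/negP; rewrite -ltNge.
  rewrite (le_lt_trans (leeD (weak1 a l F l0 mF FB) (Pc (a, l) l0)))//=.
  rewrite mu_ccube// /Q mu_hcube// -!EFinM -EFinD lte_fin.
  have q0 : (0 < l ^+ n * @hmass R n)%R by rewrite mulr_gt0// exprn_gt0.
  have cq : ((2 ^+ n.+2)^-1 * (l ^+ n * @cmass R n) <= 4^-1 * (l ^+ n * @hmass R n))%R.
    rewrite ler_pdivrMl ?exprn_gt0//.
    have := ler_wpM2l (exprn_ge0 n (ltW l0)) (@cmass_hmass R n).
    move=> /le_trans; apply; rewrite le_eqVlt; apply/orP; left; apply/eqP.
    by rewrite !exprS; field.
  have hq : ((2 ^+ n.+3)^-1 * (l ^+ n * @hmass R n) <= 8^-1 * (l ^+ n * @hmass R n))%R.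
    rewrite ler_wpM2r ?(ltW q0)// lef_pV2 ?posrE ?exprn_gt0//.
    rewrite (_ : 8 = 2 ^+ 3 :> R)%R; last by rewrite -natrX.
    by rewrite ler_eXn2l ?ltr1n.
  by lra.
pose k : R := (s + s1)%R.
apply: (@le_trans _ _ (\int[mu]_(x in Q) ((`|Re (f x) - Re (c (a, l))|)%:E +
    ((`|Im (f x) - Im (c (a, l))|)%:E + (2 * k)%:E)))).
  apply: le_integral_sub => // x _; rewrite -!EFinD !lee_fin.
    rewrite absC_ge0/=; have := absC_le (f x).
    have := normRe_le (c (a, l)); have := normIm_le (c (a, l)).
    have := ler_distD 0%R (Re (f x)) (Re (c (a, l))).
    have := ler_normD (Re (f x) - Re (c (a, l)))%R (Re (c (a, l))).
    have := ler_normD (Im (f x) - Im (c (a, l)))%R (Im (c (a, l))).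
    by rewrite !subrK /k; lra.
  by rewrite !addr_ge0// mulr_ge0// addr_ge0// ltW.
have mabs (g : V -> R) (r : R) : measurable_fun setT g ->
    measurable_fun Q (fun x => (`|g x - r|)%:E).
  move=> mg; apply/measurable_EFinP/measurable_funTS.
  apply: measurableT_comp; first exact: normr_measurable.
  by apply: measurable_funB => //; exact: measurable_cst.
have k0 : (0 <= 2 * k)%R by rewrite mulr_ge0// addr_ge0// ltW.
rewrite ge0_integralD//=; last 3 first.
- exact: mabs.
- by move=> x _; rewrite adde_ge0// lee_fin.
- by apply: emeasurable_funD => //; exact: mabs.
rewrite ge0_integralD//=; last exact: mabs.
have -> : \int[mu]_(x in Q) (2 * k)%:E = (2 * k)%:E * mu Q by exact: integral_cst.
rewrite (le_trans (leeD jsr (leeD jsi (lexx _))))//.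
rewrite /Q mu_hcube// -!EFinM -!EFinD lee_fin /k le_eqVlt.
by apply/orP; left; apply/eqP; ring.
Qed.

End local_oscillation.

(** * Atoms and the transposed operator *)

Section atoms.
Context {R : realType} {n : nat}.
Local Notation V := 'rV[R]_n.
Local Notation mu := (@lebesgue_rV R n).
Implicit Types (E : set V) (f : V -> R[i]).

(** [N_] is defined by choice, so the point is that a largest exponent exists. The bound turns the
    normalization of an atom into |f| <= 1 / |E|. *)
Lemma N_le E : 0 < vol E -> 2 ^ N_ E <= (vol E)^-1.
Proof.
move=> v0; set v := vol E in v0 *.
have exN : exists N, is_N_ E N.
  (* Exponents are shifted by [k] to search among natural numbers: [P j] says that [j - k] is
     admissible, [v < 2 ^+ k] gives [P 0], and [v^-1 < 2 ^+ k] gives the upper bound [k + k]. *)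
  pose k := (Num.truncn v + Num.truncn v^-1).+1.
  have ltk (r : R) : (Num.truncn r < k)%N -> r < 2 ^+ k.
    move=> rk; rewrite (lt_le_trans (truncnS_gt r))// -natrX ler_nat.
    by rewrite (leq_trans rk)// ltnW// ltn_expl.
  have vk : v < 2 ^+ k by apply: ltk; rewrite ltnS leq_addr.
  have ivk : v^-1 < 2 ^+ k by apply: ltk; rewrite ltnS leq_addl.
  pose P (j : nat) := 2 ^+ j * v <= 2 ^+ k.
  have exP : exists j, P j by exists 0%N; rewrite /P mul1r ltW.
  have boundP j : P j -> (j <= k + k)%N.
    rewrite /P -ler_pdivlMr// => jk; rewrite -(ler_eXn2l (x := 2 : R)) ?ltr1n//.
    by rewrite (le_trans jk)// exprD ler_wpM2l ?exprn_ge0// ltW.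
  have PE (j : nat) : P j = (2 ^ (j%:Z - k%:Z) * v <= 1).
    rewrite expfzDr ?pnatr_eq0// -exprnN /P -!exprnP.
    by rewrite mulrAC ler_pdivrMr ?exprn_gt0// mul1r.
  case: (ex_maxnP exP boundP) => j Pj maxj; exists (j%:Z - k%:Z); split.
    by rewrite -PE.
  move=> M vM; rewrite leNgt; apply/negP => jM.
  have : P j.+1.
    rewrite PE (le_trans _ vM)// ler_wpM2r ?(ltW v0)// ler_weXz2l ?ler1n//.
    by rewrite -addn1 PoszD addrAC lezD1.
  by move=> /maxj; rewrite ltnn.
have [vN _] := xgetPex 0 exN.
by rewrite -[leRHS]mul1r ler_pdivlMr.
Qed.

Lemma A1_ae_le E f : 0 < vol E -> A1_in E f ->
  {ae mu, forall x, absC (f x) <= (vol E)^-1}.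
Proof.
move=> v0 [_ _ /ess_supP + _]; apply: filterS => x.
by rewrite lee_fin => /le_trans; apply; exact: N_le.
Qed.

Lemma A1_out E f x : A1_in E f -> ~ E x -> f x = 0.
Proof.
move=> [_ fE _ _] nEx; apply/eqP/negPn/negP => fx; apply: nEx.
by apply: fE; exact: subset_closure.
Qed.

Lemma A1_bounded_compact_supp E f : compact E -> A1_in E f -> bounded_compact_supp f.
Proof.
move=> cE [mf fE fN _]; split => //; first by rewrite (le_lt_trans fN)// ltry.
by apply: subclosed_compact fE => //; exact: closed_closure.
Qed.

Lemma integral_setT_sub (D : set V) (g : V -> \bar R) : (forall x, ~ D x -> g x = 0%E) ->
  (\int[mu]_x g x = \int[mu]_(x in D) g x)%E.
Proof.
move=> g0; rewrite [RHS]integral_mkcond; apply: eq_integral => x _; rewrite patchE.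
by case: ifPn => //; rewrite notin_setE => /g0.
Qed.

Lemma cintegrable_sub (D : set V) (g : V -> R[i]) : measurable D -> cmeasurable setT g ->
  (forall x, ~ D x -> g x = 0) -> (\int[mu]_(x in D) (absC (g x))%:E < +oo)%E ->
  cintegrable mu setT g.
Proof.
move=> mD mg g0 goo; apply: absC_cintegrable => //.
by rewrite (integral_setT_sub (D := D))// => x /g0 ->; rewrite ComplexField.Normc.normc0.
Qed.

Local Open Scope ereal_scope.

Lemma integral_absC_mul_A1 E f (g : V -> R[i]) (A : set V) : (0 < vol E)%R ->
  A1_in E f -> measurable A -> cmeasurable A g ->
  \int[mu]_(x in A) (absC (g x * f x))%:E <=
  ((vol E)^-1)%:E * \int[mu]_(x in A) (absC (g x))%:E.
Proof.
move=> v0 fE mA mg; have mf : cmeasurable A f.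
  by have [[mr mi] _ _ _] := fE; split; exact: measurable_funTS.
rewrite -ge0_integralZl_EFin//; last 3 first.
- by move=> x _; rewrite lee_fin absC_ge0.
- exact/measurable_EFinP/measurable_absC.
- by rewrite invr_ge0 ltW.
apply: ae_ge0_le_integral => //.
- by move=> x _; rewrite lee_fin absC_ge0.
- by apply/measurable_EFinP/measurable_absC; exact: cmeasurableM.
- by move=> x _; rewrite -EFinM lee_fin mulr_ge0 ?absC_ge0// invr_ge0 ltW.
- apply: emeasurable_funM; first exact: measurable_cst.
  exact/measurable_EFinP/measurable_absC.
have := A1_ae_le v0 fE; apply: filterS => x fx Ax.
by rewrite -EFinM lee_fin absCM mulrC ler_wpM2r ?absC_ge0.
Qed.

End atoms.

(** * Level sets of the transpose near the atom, by duality *)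

Section near_part.
Context {R : realType} {n : nat}.
Local Notation V := 'rV[R]_n.
Local Notation mu := (@lebesgue_rV R n).
Context (T : operator R n) (eT : extends_to_bounded T) (eT' : extends_to_bounded (adjoint T)).
Context (pairT : forall f g, bounded_compact_supp f -> bounded_compact_supp g ->
  cintegrable mu setT (fun x => op_fun T f x * g x) ->
  cintegrable mu setT (fun x => f x * op_adj T g x) ->
  cintegral mu setT (fun x => op_fun T f x * g x) =
  cintegral mu setT (fun x => f x * op_adj T g x)).
Implicit Types (a b x y : V) (l L : R) (E F G : set V).
Local Open Scope ereal_scope.

Context (C0 : R) (cindicT : forall a l F, (0 < l)%R ->
  measurable F -> F `<=` hcube a l ->
  \int[mu]_(x in hcube a l) (absC (op_fun T (cindic F) x))%:E <= C0%:E * mu (hcube a l)).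

Context (E : set V) (b : V) (l : R) (l_gt0 : (0 < l)%R).
Context (cE : compact E) (vE : (0 < vol E)%R) (EQ : E `<=` hcube b l).
Context (f : V -> R[i]) (fE : A1_in E f).
Let Q := hcube b l.
(** Bounds the pairing of [T chi_F] with the atom for [F] inside [Q]; the factor 2 is that of
    [absC_cintegral_le]. *)
Let D0 : R := (2 * (C0 * ((vol E)^-1 * fine (mu Q))))%R.

Let mQ : measurable Q. Proof. exact: measurable_hcube. Qed.
Let muQ : mu Q = (fine (mu Q))%:E.
Proof. by rewrite fineK// ge0_fin_numE// mu_hcube_lty. Qed.

Let integral_indic_le F : measurable F -> F `<=` Q ->
  \int[mu]_(x in Q) (absC (op_fun T (cindic F) x * f x))%:E <=
  (C0 * ((vol E)^-1 * fine (mu Q)))%:E.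
Proof.
move=> mF FQ; have FB := subset_trans FQ (@hcube_ccube _ _ b l).
have [mr mi] := ext_measurable eT (bounded_compact_supp_cindic mF (@compact_ccube _ _ b l) FB).
have mT : cmeasurable Q (op_fun T (cindic F)) by split; exact: measurable_funTS.
rewrite (le_trans (integral_absC_mul_A1 vE fE mQ mT))//.
rewrite (le_trans (lee_wpmul2l _ (cindicT l_gt0 mF FQ)))//.
  by rewrite lee_fin invr_ge0 ltW.
by rewrite -/Q muQ -!EFinM lee_fin mulrCA.
Qed.

(** The bound [M] makes [chi_F T^* f] integrable, which the transposition formula demands; it does
    not enter the final estimate. *)
Lemma absC_cintegral_op_adj F (M : R) : measurable F -> F `<=` Q ->
  (forall x, F x -> (absC (op_adj T f x) <= M)%R) ->
  cintegrable mu F (op_adj T f) /\ (absC (cintegral mu F (op_adj T f)) <= D0)%R.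
Proof.
move=> mF FQ gM.
have FB := subset_trans FQ (@hcube_ccube _ _ b l).
have bF := bounded_compact_supp_cindic mF (@compact_ccube _ _ b l) FB.
have bf := A1_bounded_compact_supp cE fE.
have mg : cmeasurable setT (op_adj T f) by exact: (ext_measurable eT' bf).
have mgF : cmeasurable F (op_adj T f).
  by case: mg => ? ?; split; exact: measurable_funTS.
have ig : cintegrable mu F (op_adj T f).
  apply: absC_cintegrable => //.
  apply: (@le_lt_trans _ _ (\int[mu]_(x in F) `|M|%:E)).
    apply: le_integral_sub => // x Fx; rewrite !lee_fin absC_ge0/=.
    by rewrite (le_trans (gM _ Fx))// ler_norm.
  rewrite (_ : \int[mu]_(_ in F) _ = `|M|%:E * mu F); last exact: integral_cst.
  have muF : mu F = (fine (mu F))%:E.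
    rewrite fineK// ge0_fin_numE//.
    by rewrite (le_lt_trans (le_mu FQ))// mu_hcube_lty.
  by rewrite muF -EFinM ltry.
split => //.
have fout x : ~ Q x -> f x = 0%R by move=> Qx; apply: (A1_out fE) => /EQ.
have [mr mi] := ext_measurable eT bF.
have mTf : cmeasurable setT (fun x => op_fun T (cindic F) x * f x)%R.
  by have [mf _ _ _] := fE; exact: (cmeasurableM (conj mr mi) mf).
have Tf0 x : ~ Q x -> (op_fun T (cindic F) x * f x = 0)%R.
  by move=> /fout ->; rewrite mulr0.
have iTf : cintegrable mu setT (fun x => op_fun T (cindic F) x * f x)%R.
  apply: (cintegrable_sub mQ mTf Tf0).
  by rewrite (le_lt_trans (integral_indic_le mF FQ))// ltry.
have Fg0 x : ~ F x -> (cindic F x * op_adj T f x = 0)%R.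
  by move=> Fx; rewrite cindic_notin// mul0r.
have Fg1 x : F x -> (cindic F x * op_adj T f x = op_adj T f x)%R.
  by move=> Fx; rewrite cindic_in// mul1r.
have iFg : cintegrable mu setT (fun x => cindic F x * op_adj T f x)%R.
  apply: (cintegrable_sub mF _ Fg0).
    by have [mF' _ _] := bF; exact: (cmeasurableM mF' mg).
  rewrite (_ : \int[mu]_(x in F) _ = \int[mu]_(x in F) (absC (op_adj T f x))%:E).
    exact: cintegrable_absC.
  by apply: eq_integral => x; rewrite inE => /Fg1 ->.
have := pairT bF bf iTf iFg.
rewrite (cintegral_mkcond mu Fg1 Fg0) => <-.
rewrite (@cintegral_mkcond _ _ _ mu Q (fun x => op_fun T (cindic F) x * f x)%R)//.
have mTfQ : cmeasurable Q (fun x => op_fun T (cindic F) x * f x)%R.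
  by case: mTf => ? ?; split; exact: measurable_funTS.
rewrite -lee_fin (le_trans (absC_cintegral_le mu mQ mTfQ))// /D0 [leRHS]EFinM.
by rewrite lee_wpmul2l//; exact: integral_indic_le.
Qed.

(** [p] stands for one of Re, -Re, Im and -Im: a signed part lets the integral over the level set be
    bounded below by [t] times its measure. *)
Lemma level_set_part (p : R[i] -> R) (t : R) : (0 < t)%R ->
  (forall d (U : measurableType d) (D : set U) (g : U -> R[i]),
     cmeasurable D g -> measurable_fun D (p \o g)) ->
  (forall (D : set V) (g : V -> R[i]), measurable D -> cintegrable mu D g ->
     mu.-integrable D (fun x => (p (g x))%:E) /\
     (\int[mu]_(x in D) p (g x) <= absC (cintegral mu D g))%R) ->
  t%:E * mu (Q `&` [set x | (t < p (op_adj T f x))%R]) <= D0%:E.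
Proof.
move=> t0 mp ip; have bf := A1_bounded_compact_supp cE fE.
have mg : cmeasurable setT (op_adj T f) by exact: (ext_measurable eT' bf).
(* The truncation at height [k] supplies the bound [M]; the sets increase to the full level set and
   the estimate is uniform in [k]. *)
pose F (k : nat) := Q `&` [set x | (t < p (op_adj T f x))%R] `&`
  [set x | (absC (op_adj T f x) <= k%:R)%R].
have mF k : measurable (F k).
  apply: measurableI.
    apply: measurableI => //; rewrite -[X in measurable X]setTI.
    rewrite (_ : [set x | _] = (p \o op_adj T f) @^-1` `]t, +oo[).
      exact: (mp _ _ _ _ mg).
    by apply/seteqP; split => x /=; rewrite in_itv/= andbT.
  rewrite -[X in measurable X]setTI.
  rewrite (_ : [set x | _] = (fun x => absC (op_adj T f x)) @^-1` `]-oo, k%:R]).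
    exact: (measurable_absC mg).
  by apply/seteqP; split => x /=; rewrite in_itv.
have FQ k : F k `<=` Q by move=> x [[]].
rewrite -lee_pdivlMl//.
apply: (@le_trans _ _ (mu (\bigcup_k F k))).
  apply: le_mu => x xp; exists (Num.truncn (absC (op_adj T f x))).+1 => //.
  by split => //=; rewrite ltW// truncnS_gt.
apply: mu_bigcup_sup_le => // [k x [xp /= xk]|k].
  by split => //=; rewrite (le_trans xk)// ler_nat.
rewrite lee_pdivlMl//.
have [ig gD] := absC_cintegral_op_adj (mF k) (FQ k) (fun x (xF : F k x) => xF.2).
have [ipg pg] := ip _ _ (mF k) ig.
apply: (@le_trans _ _ (\int[mu]_(x in F k) (p (op_adj T f x))%:E)).
  rewrite -(integral_cst mu (mF k) t%:E); apply: le_integral_sub => //.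
    by move=> x [[_ /= tx] _]; rewrite !lee_fin (ltW t0) ltW.
  by move=> x [[_ /= tx] _]; rewrite lee_fin (le_trans (ltW t0))// ltW.
have pfin := integrable_fin_num (mF k) ipg.
by rewrite -(fineK pfin) lee_fin; exact: le_trans pg gD.
Qed.

(** If |z| > t then one of the four signed parts exceeds [t / 2]; each of them contributes
    [2 * D0]. *)
Lemma near_level_set (t : R) : (0 < t)%R ->
  t%:E * mu (Q `&` [set x | (t < absC (op_adj T f x))%R]) <= (8 * D0)%:E.
Proof.
move=> t0; have t20 : (0 < t / 2)%R by rewrite divr_gt0.
pose S (p : R[i] -> R) := Q `&` [set x | (t / 2 < p (op_adj T f x))%R].
have part_le (p : R[i] -> R) : (t / 2)%:E * mu (S p) <= D0%:E ->
    t%:E * mu (S p) <= (2 * D0)%:E.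
  have two0 : 0 <= (2%:E : \bar R) by rewrite lee_fin.
  move=> /(lee_wpmul2l two0); rewrite muleA -!EFinM.
  by rewrite (_ : 2 * (t / 2) = t)%R//; field.
have re : t%:E * mu (S (fun z => Re z)) <= (2 * D0)%:E.
  apply/part_le/level_set_part => // [d U D g [? _] //|D g mD ig].
  by split; [case: ig|exact: le_trans (ler_norm _) (normRe_le (cintegral mu D g))].
have im : t%:E * mu (S (fun z => Im z)) <= (2 * D0)%:E.
  apply/part_le/level_set_part => // [d U D g [_ ?] //|D g mD ig].
  by split; [case: ig|exact: le_trans (ler_norm _) (normIm_le (cintegral mu D g))].
have rn : t%:E * mu (S (fun z => - Re z)%R) <= (2 * D0)%:E.
  apply/part_le/level_set_part => // [d U D g [mr _]|D g mD [ir ii]].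
    exact: measurableT_comp.
  split; first exact: (integrableN ir).
  rewrite (_ : \int[mu]_(x in D) _ = - Re (cintegral mu D g))%R; last first.
    rewrite -mulN1r -RintegralZl//; apply: eq_Rintegral => x _.
    by rewrite mulN1r.
  by rewrite (le_trans (ler_norm _))// normrN normRe_le.
have imn : t%:E * mu (S (fun z => - Im z)%R) <= (2 * D0)%:E.
  apply/part_le/level_set_part => // [d U D g [_ mi]|D g mD [ir ii]].
    exact: measurableT_comp.
  split; first exact: (integrableN ii).
  rewrite (_ : \int[mu]_(x in D) _ = - Im (cintegral mu D g))%R; last first.
    rewrite -mulN1r -RintegralZl//; apply: eq_Rintegral => x _.
    by rewrite mulN1r.
  by rewrite (le_trans (ler_norm _))// normrN normIm_le.
pose S4 := (S (fun z => Re z) `|` S (fun z => - Re z)%R) `|`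
           (S (fun z => Im z) `|` S (fun z => - Im z)%R).
apply: (@le_trans _ _ (t%:E * mu S4)).
  rewrite lee_wpmul2l ?lee_fin ?(ltW t0)//; apply: le_mu => x [xQ /= xt].
  have := absC_le (op_adj T f x); set g := op_adj T f x in xt *.
  have [re1|re1] := ltP (t / 2)%R `|Re g|%R.
    move=> _; left; move: re1; rewrite ltr_normr => /orP[] ?; [left|right]; by split.
  move=> le_sum; have : (t / 2 < `|Im g|)%R by lra.
  by rewrite ltr_normr => /orP[] ?; right; [left|right].
apply: (@le_trans _ _ (t%:E * ((mu (S (fun z => Re z)) + mu (S (fun z => - Re z)%R)) +
           (mu (S (fun z => Im z)) + mu (S (fun z => - Im z)%R))))).
  rewrite lee_wpmul2l ?lee_fin ?(ltW t0)//.
  by rewrite (le_trans (muU_le _ _))// leeD// muU_le.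
rewrite !ge0_muleDr ?adde_ge0//.
rewrite (le_trans (leeD (leeD re rn) (leeD im imn)))// -!EFinD lee_fin.
by rewrite le_eqVlt; apply/orP; left; apply/eqP; ring.
Qed.

End near_part.

(** * Level sets of the transpose far from the atom, by Hormander's condition *)

Section far_part.
Context {R : realType} {n : nat} (n_gt0 : (0 < n)%N).
Local Notation V := 'rV[R]_n.
Local Notation mu := (@lebesgue_rV R n).
Context (T : operator R n) (kernelT : has_kernel T) (eT' : extends_to_bounded (adjoint T)).
Let K := op_kernel T.
Implicit Types (a b x y : V) (l L : R).
Local Open Scope ereal_scope.

Context (H0 : R) (H0_ge0 : (0 <= H0)%R) (hormanderT : forall x x',
  \int[mu]_(y in [set y : V | (enorm (x - y) >= 2 * enorm (x - x'))%R])
     (absC (K x y - K x' y) + absC (K y x - K y x'))%:E <= H0%:E).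

Context (e : V) (l : R) (l_gt0 : (0 < l)%R).
Let E := ccube e l.
Context (vE : (0 < vol E)%R) (f : V -> R[i]) (fE : A1_in E f).

Let cE : compact E. Proof. exact: compact_ccube. Qed.
Let mE : measurable E. Proof. exact: measurable_ccube. Qed.
Let Ee : E e. Proof. by move=> i; rewrite lexx lerDl ltW. Qed.
Let muE : mu E = (vol E)%:E.
Proof. by rewrite /vol fineK// ge0_fin_numE// mu_ccube_lty. Qed.
Let mf : cmeasurable E f.
Proof. by have [[mr mi] _ _ _] := fE; split; exact: measurable_funTS. Qed.

Let cintegrable_mul (g : V -> R[i]) : cmeasurable E g ->
  \int[mu]_(x in E) (absC (g x))%:E < +oo ->
  cintegrable mu E (fun x => g x * f x)%R.
Proof.
move=> mg goo; apply: (absC_cintegrable mE (cmeasurableM mg mf)).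
rewrite (le_lt_trans (integral_absC_mul_A1 vE fE mE mg))//.
by rewrite lte_mul_pinfty// lee_fin invr_ge0 ltW.
Qed.

(* The mean value zero of the atom allows to subtract the kernel at [e]. *)
Let cintegral_kernel_sub (k : V -> R[i]) (c : R[i]) : cintegrable mu E k ->
  cintegral mu E (fun y => k y * f y)%R = cintegral mu E (fun y => (k y - c) * f y)%R.
Proof.
move=> ik.
have f0 : cintegral mu E f = 0%R.
  have [_ _ _ <-] := fE; apply/esym/cintegral_mkcond => // x.
  exact: (A1_out fE).
have cst_fin (d : R[i]) : \int[mu]_(x in E) (absC d)%:E < +oo.
  rewrite (_ : \int[mu]_(x in E) _ = (absC d)%:E * mu E); last exact: integral_cst.
  by rewrite muE -EFinM ltry.
have cst_m (d : R[i]) : cmeasurable E (fun _ : V => d) by split; exact: measurable_cst.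
have icf := cintegrable_mul (cst_m c) (cst_fin c).
have [ifr ifi] : cintegrable mu E f.
  have := cintegrable_mul (cst_m 1%R) (cst_fin 1%R).
  by rewrite (_ : (fun x => 1 * f x)%R = f)//; apply/funext => x; rewrite mul1r.
have ikf : cintegrable mu E (fun y => k y * f y)%R.
  by apply: cintegrable_mul; [exact: cintegrable_cmeasurable ik|exact: cintegrable_absC].
have cf0 : cintegral mu E (fun y => c * f y)%R = 0%R.
  have fr0 : (\int[mu]_(x in E) Re (f x))%R = 0%R := congr1 Re f0.
  have fi0 : (\int[mu]_(x in E) Im (f x))%R = 0%R := congr1 Im f0.
  have zint (r : R) (g : V -> R) : mu.-integrable E (EFin \o g) ->
      mu.-integrable E (EFin \o (fun x => r * g x)%R).
    move=> ig; rewrite (_ : _ \o _ = (fun x => r%:E * (g x)%:E))//.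
    exact: (integrableZl mE r ig).
  apply: complex_eq => /=.
    under eq_Rintegral do rewrite cReM.
    rewrite RintegralB//; [|exact: zint ifr|exact: zint ifi].
    by rewrite !RintegralZl// fr0 fi0 !mulr0 subrr.
  under eq_Rintegral do rewrite cImM.
  rewrite RintegralD//; [|exact: zint ifi|exact: zint ifr].
  by rewrite !RintegralZl// fr0 fi0 !mulr0 addr0.
rewrite -[LHS]subr0 -cf0 -cintegralB//; apply: eq_cintegral => y _.
by rewrite mulrBl.
Qed.

(** At almost every far point, [T^* f] is the integral over [E] of [(K y x - K e x) * f y]. Tonelli
    and Hormander's condition in [x] bound its integral over [B], and Chebyshev's inequality
    concludes. Intersecting with [ccube b L] makes [B] compact, so that the kernel is integrable on
    [E] times [B]. *)
Let far_level_set_bounded (b : V) (L t : R) : (0 < t)%R ->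
  t%:E * mu (ccube b L `&` far e l `&` [set x | (t < absC (op_adj T f x))%R]) <=
  (2 * H0)%:E.
Proof.
move=> t0; set B := ccube b L `&` far e l.
have cB : compact B.
  apply: (@subclosed_compact _ _ (ccube b L)); [|exact: compact_ccube|by move=> x []].
  by apply: closedI; [exact: closed_ccube|exact: closed_far].
have mB : measurable B.
  by apply: measurableI; [exact: measurable_ccube|exact: measurable_far].
have EB : E `&` B = set0.
  by rewrite /B setICA (far_ccube_disjoint e n_gt0 l_gt0) setI0.
have bf := A1_bounded_compact_supp cE fE.
have mg : cmeasurable setT (op_adj T f) by exact: (ext_measurable eT' bf).
pose h (z : V * V) : \bar R := (2 * (absC (K z.1 z.2 - K e z.2) * absC (f z.1)))%:E.
have mKe := cmeasurable_kernel1 kernelT cE cB EB mE mB Ee.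
have mK : cmeasurable (E `*` B) (fun z : V * V => K z.1 z.2 - K e z.2)%R.
  apply: cmeasurableB.
    exact: cintegrable_cmeasurable (kernel_rectangle kernelT cE cB EB).
  by case: mKe => mr mi; split; [exact: (measurable_fun_snd mE mB mr)|
    exact: (measurable_fun_snd mE mB mi)].
have mh : measurable_fun (E `*` B) h.
  apply/measurable_EFinP; apply: measurable_funM => //.
  apply: measurable_funM; first exact: measurable_absC.
  exact: (measurable_fun_fst mE mB (measurable_absC mf)).
have h0 z : 0 <= h z by rewrite lee_fin !mulr_ge0 ?absC_ge0.
have inth : \int[mu]_(x in B) \int[mu]_(y in E) h (y, x) <= (2 * H0)%:E.
  rewrite -(tonelli_rectangle mu mu mE mB mh)//.
  apply: (@le_trans _ _ (\int[mu]_(y in E) (2 * H0 * absC (f y))%:E)).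
    apply: le_integral_sub => // y yE; last by rewrite lee_fin !mulr_ge0 ?absC_ge0.
    apply/andP; split; first exact: integral_ge0.
    rewrite (_ : \int[mu]_(x in B) _ =
        (2 * absC (f y))%:E * \int[mu]_(x in B) (absC (K y x - K e x))%:E).
      rewrite mulrAC [leRHS]EFinM lee_wpmul2l ?lee_fin ?mulr_ge0 ?absC_ge0//.
      apply: le_trans (hormanderT y e); apply: le_integral_sub.
      - by move=> x [_ xf] /=; apply: far_separated xf.
      - by move=> x _; rewrite !lee_fin absC_ge0/= lerDl absC_ge0.
      - by move=> x _; rewrite lee_fin addr_ge0 ?absC_ge0.
    rewrite -ge0_integralZl_EFin//.
    - by apply: eq_integral => x _; rewrite /h/= -EFinM; congr EFin; ring.
    - by move=> x _; rewrite lee_fin absC_ge0.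
    - apply/measurable_EFinP/measurable_absC.
      exact: (cmeasurableB (cmeasurable_kernel1 kernelT cE cB EB mE mB yE) mKe).
    - by rewrite mulr_ge0 ?absC_ge0.
  (* As |f| <= 1 / |E| almost everywhere, the atom has integral norm at most 1. *)
  apply: (@le_trans _ _ (\int[mu]_(y in E) (2 * H0 * (vol E)^-1)%:E)).
    apply: ae_ge0_le_integral => //.
    - by move=> y _; rewrite lee_fin !mulr_ge0 ?absC_ge0.
    - by apply/measurable_EFinP/measurable_funM => //; exact: measurable_absC.
    - by move=> y _; rewrite lee_fin !mulr_ge0// invr_ge0 ltW.
    have := A1_ae_le vE fE; apply: filterS => y fy _.
    by rewrite lee_fin ler_wpM2l// mulr_ge0.
  rewrite (_ : \int[mu]_(y in E) _ = (2 * H0 * (vol E)^-1)%:E * mu E); last exact: integral_cst.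
  by rewrite muE -EFinM divfK// gt_eqF.
have [N [mN N0 badN]] : {ae mu, forall x, B x ->
    (absC (op_adj T f x))%:E <= \int[mu]_(y in E) h (y, x)}.
  have := ext_kernel eT' bf.
  have := cintegrable_kernel2 kernelT cE cB EB mE mB.
  apply: filterS2 => x ik Tx xB.
  have {}Tx : op_adj T f x = cintegral mu E (fun y => (K y x - K e x) * f y)%R.
    rewrite -cintegral_kernel_sub; last exact: ik.
    rewrite [LHS]Tx; last first.
      move=> fx; have : (E `&` B) x by split => //; have [_ + _ _] := fE; exact.
      by rewrite EB.
    apply: cintegral_mkcond => // y yE.
    by rewrite (A1_out fE yE) mulr0.
  have mKx : cmeasurable E (fun y => (K y x - K e x) * f y)%R.
    apply: (cmeasurableM _ mf).
    apply: (cmeasurableB (cintegrable_cmeasurable (ik xB))).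
    by split; exact: measurable_cst.
  rewrite Tx (le_trans (absC_cintegral_le mu mE mKx))//.
  rewrite -ge0_integralZl_EFin//.
  - apply: le_integral_sub => // y _.
    by rewrite -EFinM /h/= absCM lexx lee_fin !mulr_ge0 ?absC_ge0.
  - by move=> y _; rewrite lee_fin absC_ge0.
  - by apply/measurable_EFinP/measurable_absC.
(* Removing the null set [N] makes the pointwise bound hold on all of [X] without changing the
   measure. *)
pose X := B `&` [set x | (t < absC (op_adj T f x))%R] `\` N.
have mX : measurable X.
  apply: measurableD => //; apply: measurableI => //.
  rewrite -[X in measurable X]setTI.
  rewrite (_ : [set x | _] = (fun x => absC (op_adj T f x)) @^-1` `]t, +oo[).
    exact: (measurable_absC mg).
  by apply/seteqP; split => x /=; rewrite in_itv/= andbT.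
apply: (@le_trans _ _ (t%:E * mu X)).
  rewrite lee_wpmul2l ?lee_fin ?(ltW t0)// -[leRHS]adde0 -[X in _ <= _ + X]N0.
  rewrite (le_trans _ (muU_le _ _))//; apply: le_mu => x xB.
  by have [xN|xN] := pselect (N x); [right|left].
apply: le_trans inth; rewrite -(integral_cst mu mX t%:E); apply: le_integral_sub.
- by move=> x [[]].
- move=> x [[xB /= xt] xN]; rewrite lee_fin (ltW t0)/=.
  apply: (@le_trans _ _ (absC (op_adj T f x))%:E); first by rewrite lee_fin ltW.
  by apply: contrapT => bad; apply: xN; apply: badN => /(_ xB).
- by move=> x _; exact: integral_ge0.
Qed.

(** The bound on bounded pieces is uniform, and growing cubes exhaust the far set. *)
Lemma far_level_set (t : R) : (0 < t)%R ->
  t%:E * mu (far e l `&` [set x | (t < absC (op_adj T f x))%R]) <= (2 * H0)%:E.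
Proof.
move=> t0; rewrite -lee_pdivlMl//.
have bf := A1_bounded_compact_supp cE fE.
have mg : cmeasurable setT (op_adj T f) by exact: (ext_measurable eT' bf).
pose C k : set V := ccube (const_mx (- k%:R))%R (2 * k%:R)%R.
pose X k := C k `&` far e l `&` [set x | (t < absC (op_adj T f x))%R].
apply: (@le_trans _ _ (mu (\bigcup_k X k))).
  apply: le_mu => x [xf xt]; exists (\sum_(i < n) (Num.truncn `|x 0%R i|%R).+1)%N => //.
  split => //; split => // i; rewrite !mxE.
  have xn : (`|x 0%R i| < (\sum_(i < n) (Num.truncn `|x 0%R i|%R).+1)%:R)%R.
    rewrite (lt_le_trans (truncnS_gt _))// ler_nat (bigD1 i)//= leq_addr//.
  by move: xn; rewrite ltr_norml => /andP[? ?]; apply/andP; split; lra.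
apply: mu_bigcup_sup_le => k.
- apply: measurableI.
    by apply: measurableI; [exact: measurable_ccube|exact: measurable_far].
  rewrite -[X in measurable X]setTI.
  rewrite (_ : [set x | _] = (fun x => absC (op_adj T f x)) @^-1` `]t, +oo[).
    exact: (measurable_absC mg).
  by apply/seteqP; split => x /=; rewrite in_itv/= andbT.
- move=> x [[xC xf] xt]; split => //; split => // i; have := xC i; rewrite !mxE -natr1.
  by move=> /andP[? ?]; apply/andP; split; lra.
- by rewrite lee_pdivlMl//; exact: far_level_set_bounded.
Qed.

End far_part.

Theorem theorem1p4 (R : realType) (n : nat) (n_gt0 : (0 < n)%N)
    (T : operator R n) :
  HCZ T -> extended_action T ->
  bounded_to_WL1 T A01 -> bounded_to_WL1 (adjoint T) A1.
Proof.
move=> hT [eT eT' pairT] wT.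
have WL1_le (C : R) (g : 'rV[R]_n -> R[i]) : (forall t : R, 0 < t ->
    (t%:E * lebesgue_rV [set x | (t < absC (g x))%R] <= C%:E)%E) ->
    (WL1_norm g <= C%:E)%E.
  by move=> gC; apply: ge_ereal_sup => _ [t t0 <-]; exact: gC.
suff [C AC] : exists C : R, forall f E, is_cube E -> A1_in E f -> forall t : R, 0 < t ->
    (t%:E * lebesgue_rV [set x | (t < absC (op_adj T f x))%R] <= C%:E)%E.
  apply: (@le_lt_trans _ _ C%:E); last exact: ltry.
  by apply: ge_ereal_sup => _ [f [E cE fE] <-]; apply: WL1_le; exact: AC cE fE.
have := @hmass_ge0 R n; rewrite le_eqVlt => /orP[/eqP/esym h0|h0].
  exists 0 => f E _ _ t t0.
  rewrite (_ : lebesgue_rV _ = 0%E) ?mule0//; apply/eqP; rewrite eq_le measure_ge0 andbT.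
  by rewrite -(mu_eq0 h0); exact: le_mu.
have [Z Z0 sizeT] := ereal_sup_lty (HCZ_size hT).
have {}sizeT x (r : R) : 0 < r -> (\int[lebesgue_rV]_(y in [set y : 'rV[R]_n |
     (r <= enorm (x - y) <= 2 * r)%R])
     (absC (op_kernel T x y) + absC (op_kernel T y x))%:E <= Z%:E)%E.
  by move=> r0; apply: sizeT; exists (x, r).
have [H0 H00 horT] := ereal_sup_lty (HCZ_hormander hT).
have {}horT x x' : (\int[lebesgue_rV]_(y in [set y : 'rV[R]_n |
     (enorm (x - y) >= 2 * enorm (x - x'))%R])
     (absC (op_kernel T x y - op_kernel T x' y) +
      absC (op_kernel T y x - op_kernel T y x'))%:E <= H0%:E)%E.
  by apply: horT; exists (x, x').
have [A0 A00 weakT] := ereal_sup_lty wT.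
have {}weakT f : A01 f -> forall t : R, 0 < t ->
    (t%:E * lebesgue_rV [set x | (t < absC (op_fun T f x))%R] <= A0%:E)%E.
  move=> Af t t0; apply: le_trans (weakT (WL1_norm (op_fun T f)) _); last by exists f.
  by apply: ereal_sup_ubound; exists t.
have kT := HCZ_kernel hT.
have small := local_weak n_gt0 h0 kT eT Z0 sizeT A00 weakT.
have [C0 C00 cindicT] := integral_op_fun_cindic n_gt0 h0 kT eT H00 horT small.
(* 16 is the 8 of [near_level_set] times the 2 of the pairing bound, and [(4 * n).+2%:R ^+ n] bounds
   the ratio of the measures of the two cubes, as [hmass <= cmass]. *)
exists (16 * C0 * (4 * n).+2%:R ^+ n + 2 * H0) => f _ [e [l [l0 ->]]].
rewrite -/(ccube e l) => fE t t0.
(* The near set fits into a closed cube of side [(4 * n).+1%:R * l]; one more [l] lets a half-open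
   cube contain it. *)
pose b := e - const_mx ((2 * n)%:R * l); pose L := (4 * n).+2%:R * l.
have L0 : 0 < L by rewrite mulr_gt0.
have c0 : 0 < @cmass R n by exact: lt_le_trans hmass_cmass.
have volE : vol (ccube e l) = l ^+ n * @cmass R n by rewrite /vol mu_ccube.
have v0 : 0 < vol (ccube e l) by rewrite volE mulr_gt0// exprn_gt0.
have starQ : ~` far e l `<=` hcube b L.
  move=> x /near_ccube; apply: ccube_hcube.
  by rewrite /L ltr_pM2r// ltr_nat.
have EQ : ccube e l `<=` hcube b L.
  move=> x xE; apply: starQ => xf.
  have := far_ccube_disjoint e n_gt0 l0; apply/eqP/set0P.
  by exists x.
have near := near_level_set eT eT' pairT cindicT L0 (@compact_ccube _ _ e l)
  v0 EQ fE t0.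
have far_t := far_level_set n_gt0 kT eT' H00 horT l0 v0 fE t0.
set S := [set x | _] in near far_t *.
apply: (@le_trans _ _ (t%:E *
    (lebesgue_rV (hcube b L `&` S) + lebesgue_rV (far e l `&` S)))%E).
  rewrite lee_wpmul2l ?lee_fin ?(ltW t0)// (le_trans _ (muU_le _ _))//.
  apply: le_mu => x xS; have [xf|xf] := pselect (far e l x); first by right.
  by left; split => //; exact: starQ.
rewrite ge0_muleDr// (le_trans (leeD near far_t))// -EFinD lee_fin lerD2r.
rewrite volE mu_hcube//= /L exprMn; set q := _.+2%:R ^+ n.
have -> : 8 * (2 * (C0 * ((l ^+ n * @cmass R n)^-1 * (q * l ^+ n * @hmass R n)))) =
    16 * C0 * q * (@hmass R n / @cmass R n).
  by field; rewrite !gt_eqF ?exprn_gt0.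
by rewrite ler_piMr ?mulr_ge0 ?exprn_ge0// ler_pdivrMr// mul1r hmass_cmass.
Qed.
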